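(* Let $\lambda$ be a partition and set $R:=R_\lambda$. (i) The following three sets of tableaux of shape $\lambda$ coincide: the set of $\lambda$-keys $Y_\lambda(\pi)$ of the $R$-312-avoiding $R$-permutations $\pi$; the set of gapless $\lambda$-keys; and the set of $\lambda$-row end max tableaux $M_\lambda(\gamma)$ of the gapless $R$-tuples $\gamma$. (ii) An $R$-permutation $\pi$ is $R$-312-avoiding if and only if its $\lambda$-key $Y_\lambda(\pi)$ is gapless. (iii) If an $R$-permutation $\pi$ is $R$-312-avoiding, then $M_\lambda(\Psi_R(\pi))=Y_\lambda(\pi)$. Moreover, the map sending an $R$-chain $B$ to the $\lambda$-key whose column $j$ consists of the elements of $B_h$ (where $\zeta_j=q_h$; columns of length $n$ consist of $[n]$) restricts to a bijection from the set of $R$-rightmost clump deleting $R$-chains onto the set of gapless $\lambda$-keys, and $\gamma\mapsto M_\lambda(\gamma)$ is a bijection from the set of gapless $R$-tuples onto the set of $\lambda$-row end max tableaux of gapless $R$-tuples.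
   Context: Fix $n\ge1$; $[m]=\{1,\dots,m\}$. For a finite $Q\subseteq\mathbb{Z}$, $\mathrm{rank}^d(Q)$ is its $d$-th largest element. For $R\subseteq[n-1]$ with elements $q_1<\dots<q_r$, set $q_0:=0$, $q_{r+1}:=n$, $p_h:=q_h-q_{h-1}$; the $h$-th carrel is $(q_{h-1},q_h]=\{q_{h-1}+1,\dots,q_h\}$. An $R$-tuple is an $n$-tuple with entries in $[n]$; it is upper if $\nu_i\ge i$ for all $i$ and $R$-increasing if strictly increasing on each carrel. An $R$-permutation is an $R$-increasing permutation of $[n]$ (one-line notation). It is $R$-312-containing if there exist $h\in[r-1]$ and $1\le a\le q_h<b\le q_{h+1}<c\le n$ with $\pi_b<\pi_c<\pi_a$, and $R$-312-avoiding otherwise. An $R$-chain is $\emptyset=B_0\subset B_1\subset\cdots\subset B_{r+1}=[n]$ with $|B_h|=q_h$; the $R$-chain of $\pi$ is $B_h=\{\pi_1,\dots,\pi_{q_h}\}$. A clump of a finite set of integers is a maximal subset of consecutive integers; clumps are indexed $L_1,\dots,L_f$ increasingly. An $R$-chain is $R$-rightmost clump deleting if for each $h\in[r]$, writing $B_{h+1}=L_1\cup\cdots\cup L_f$ as clumps, there is $e\in[f]$ with $L_e\cup\cdots\cup L_f\supseteq B_{h+1}\setminus B_h\supseteq L_{e+1}\cup\cdots\cup L_f$. A gapless $R$-tuple is an upper $R$-increasing $R$-tuple $\gamma$ such that whenever $h\in[r]$ has $\gamma_{q_h}>\gamma_{q_h+1}$, setting $s:=\gamma_{q_h}-\gamma_{q_h+1}+1$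 one has $s\le p_{h+1}$ and $\gamma_{q_h+t}=\gamma_{q_h}-s+t$ for $t\in[s]$. The rank $R$-tuple $\Psi_R(\pi)=\psi$ is defined by $\psi_i:=\mathrm{rank}^{q_h-i+1}(B_h)$ for $i\in(q_{h-1},q_h]$, $B$ the $R$-chain of $\pi$. A partition is $\lambda=(\lambda_1\ge\cdots\ge\lambda_n\ge0)\in\mathbb{Z}^n$; boxes $(j,i)$ (column $j$, row $i$), $1\le j\le\lambda_1$, $1\le i\le\zeta_j:=\#\{i:\lambda_i\ge j\}$. $R_\lambda:=\{\zeta_j:\zeta_j<n\}$; below $R=R_\lambda$ with the notation $q_h,r,p_h$. A tableau of shape $\lambda$ is a filling with values in $[n]$ strictly increasing down columns and weakly increasing along rows; $\mathcal{T}_\lambda$ is their set, ordered entrywise. $T_j(i)$ is the entry at column $j$, row $i$; $B(T_j)$ is the set of entries of column $j$; a latent column $0$ with $T_0(i)=i$ is used when needed. A $\lambda$-key is $Y\in\mathcal{T}_\lambda$ with $B(Y_l)\supseteq B(Y_j)$ for $l\le j$. The $\lambda$-key $Y_\lambda(\pi)$ of an $R_\lambda$-permutation $\pi$ is the tableau whose column $j$ consists of the elements of $\{\pi_1,\dots,\pi_{\zeta_j}\}$ in increasing order. A $\lambda$-key $Y$ is gapless if for every $h\in[r-1]$ the following holds: let $b$ be the smallest value in the columns of length $q_{h+1}$ that does not appear in the columns of length $q_h$, and $m$ the largest value in the columns of length $q_h$; if $b\le m$ then every column of length $q_{h+1}$ contains all of $b,b+1,\dots,m$ (in consecutive rows).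 The $\lambda$-row end list of $T$ is $\omega_i:=T_{\lambda_i}(i)$; for an upper $R_\lambda$-increasing tuple $\alpha$, $M_\lambda(\alpha)$ is the maximum element (under entrywise order) of the nonempty, join-closed set of $T\in\mathcal{T}_\lambda$ with $\lambda$-row end list $\alpha$. *)

(* Defs.v *)
From mathcomp Require Import all_boot.
Set Implicit Arguments. Unset Strict Implicit. Unset Printing Implicit Defensive.

(* Conventions.
   - Finite sets of positive integers are represented canonically as strictly
     increasing sequences (sorted ltn).
   - n-tuples / one-line permutations are sequences of length n, accessed
     1-indexed via [ent].
   - A set R = {q_1 < ... < q_r} ⊆ [n-1] is the increasing list [q_1;..;q_r];
     q_0 := 0, q_{r+1} := n.
   - A tableau of shape lam is the list of its columns (column j = entries
     top to bottom), accessed 1-indexed. *)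

Definition ent (s : seq nat) (i : nat) : nat := nth 0 s i.-1.

Definition qq (n : nat) (R : seq nat) (h : nat) : nat := nth 0 (0 :: R ++ [:: n]) h.
Definition pp (n : nat) (R : seq nat) (h : nat) : nat := qq n R h - qq n R h.-1.

Definition rank (d : nat) (Q : seq nat) : nat := nth 0 (sort geq (undup Q)) d.-1.

Definition Rtuple (n : nat) (nu : seq nat) : Prop :=
  size nu = n /\ forall i, 1 <= i <= n -> 1 <= ent nu i <= n.

Definition upper (n : nat) (nu : seq nat) : Prop :=
  forall i, 1 <= i <= n -> i <= ent nu i.

Definition R_increasing (n : nat) (R : seq nat) (nu : seq nat) : Prop :=
  forall h, 1 <= h <= (size R).+1 ->
  forall i, qq n R h.-1 < i < qq n R h -> ent nu i < ent nu i.+1.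

Definition Rperm (n : nat) (R : seq nat) (pi : seq nat) : Prop :=
  perm_eq pi (iota 1 n) /\ R_increasing n R pi.

Definition R312_containing (n : nat) (R : seq nat) (pi : seq nat) : Prop :=
  exists h a b c,
    [/\ 1 <= h <= (size R).-1,
        1 <= a <= qq n R h,
        qq n R h < b <= qq n R h.+1,
        qq n R h.+1 < c <= n &
        ent pi b < ent pi c < ent pi a].

Definition R312_avoiding (n : nat) (R : seq nat) (pi : seq nat) : Prop :=
  ~ R312_containing n R pi.

(* R-chains B_0 ⊂ ... ⊂ B_{r+1}, stored as the list [B_0; ...; B_{r+1}] *)
Definition Rchain (n : nat) (R : seq nat) (B : seq (seq nat)) : Prop :=
  [/\ size B = (size R).+2 /\
        (forall h, h <= (size R).+1 -> sorted ltn (nth [::] B h)),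
      nth [::] B 0 = [::],
      nth [::] B (size R).+1 = iota 1 n,
      forall h, h <= size R ->
        ({subset nth [::] B h <= nth [::] B h.+1} /\ nth [::] B h != nth [::] B h.+1) &
      forall h, h <= (size R).+1 -> size (nth [::] B h) = qq n R h].

Definition chain_of (n : nat) (R : seq nat) (pi : seq nat) : seq (seq nat) :=
  [seq sort leq (take (qq n R h) pi) | h <- iota 0 (size R).+2].

(* clumps of a finite set of integers (given as strictly increasing list),
   listed in increasing order: maximal runs of consecutive integers *)
Fixpoint clumps (s : seq nat) : seq (seq nat) :=
  match s with
  | [::] => [::]
  | x :: s' =>
      match clumps s' with
      | (y :: c) :: cs =>
          if y == x.+1 then (x :: y :: c) :: cs else [:: x] :: (y :: c) :: cs
      | cs => [:: x] :: cs
      end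
  end.

Definition RCD (n : nat) (R : seq nat) (B : seq (seq nat)) : Prop :=
  forall h, 1 <= h <= size R ->
    let S := nth [::] B h.+1 in
    let D := [seq x <- S | x \notin nth [::] B h] in
    let cs := clumps S in
    exists e, [/\ 1 <= e <= size cs,
                  {subset D <= flatten (drop e.-1 cs)} &
                  {subset flatten (drop e cs) <= D}].

Definition gapless_tuple (n : nat) (R : seq nat) (g : seq nat) : Prop :=
  [/\ Rtuple n g, upper n g, R_increasing n R g &
      forall h, 1 <= h <= size R ->
        ent g (qq n R h).+1 < ent g (qq n R h) ->
        let s := ent g (qq n R h) - ent g (qq n R h).+1 + 1 in
        s <= pp n R h.+1 /\
        forall t, 1 <= t <= s -> ent g (qq n R h + t) = ent g (qq n R h) - s + t].

(* carrel index of i: the h with q_{h-1} < i <= q_h *)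
Definition carrel (R : seq nat) (i : nat) : nat := (count (fun q => q < i) R).+1.

Definition Psi (n : nat) (R : seq nat) (pi : seq nat) : seq nat :=
  [seq rank (qq n R (carrel R i) - i + 1) (nth [::] (chain_of n R pi) (carrel R i))
  | i <- iota 1 n].

Definition is_partition (n : nat) (lam : seq nat) : Prop :=
  size lam = n /\ sorted geq lam.

Definition zeta (lam : seq nat) (j : nat) : nat := count (fun x => j <= x) lam.

Definition R_of (n : nat) (lam : seq nat) : seq nat :=
  [seq q <- iota 1 n.-1 | has (fun j => zeta lam j == q) (iota 1 (ent lam 1))].

Definition col (T : seq (seq nat)) (j : nat) : seq nat := nth [::] T j.-1.
Definition Tent (T : seq (seq nat)) (j i : nat) : nat := ent (col T j) i.

Definition tableau (n : nat) (lam : seq nat) (T : seq (seq nat)) : Prop :=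
  [/\ size T = ent lam 1,
      forall j, 1 <= j <= ent lam 1 ->
        [/\ size (col T j) = zeta lam j, sorted ltn (col T j) &
            forall x, x \in col T j -> 1 <= x <= n] &
      forall j i, 1 <= j < ent lam 1 -> 1 <= i <= zeta lam j.+1 ->
        Tent T j i <= Tent T j.+1 i].

Definition tle (lam : seq nat) (T U : seq (seq nat)) : Prop :=
  forall j i, 1 <= j <= ent lam 1 -> 1 <= i <= zeta lam j -> Tent T j i <= Tent U j i.

Definition lam_key (n : nat) (lam : seq nat) (Y : seq (seq nat)) : Prop :=
  tableau n lam Y /\
  forall l j, 1 <= l <= j -> j <= ent lam 1 -> {subset col Y j <= col Y l}.

Definition Ylam (lam : seq nat) (pi : seq nat) : seq (seq nat) :=
  [seq sort leq (take (zeta lam j) pi) | j <- iota 1 (ent lam 1)].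

Definition vals_len (lam : seq nat) (Y : seq (seq nat)) (q : nat) : seq nat :=
  flatten [seq col Y j | j <- iota 1 (ent lam 1) & zeta lam j == q].

Definition gapless_key (n : nat) (lam : seq nat) (Y : seq (seq nat)) : Prop :=
  lam_key n lam Y /\
  let R := R_of n lam in
  forall h, 1 <= h <= (size R).-1 ->
    let Vh := vals_len lam Y (qq n R h) in
    let Vh1 := vals_len lam Y (qq n R h.+1) in
    forall b m,
      b \in Vh1 -> b \notin Vh ->
      (forall x, x \in Vh1 -> x \notin Vh -> b <= x) ->
      m \in Vh -> (forall x, x \in Vh -> x <= m) ->
      b <= m ->
      forall j, 1 <= j <= ent lam 1 -> zeta lam j = qq n R h.+1 ->
        forall x, b <= x <= m -> x \in col Y j.

(* lam-row end list, with latent column 0 (T_0(i) = i) *)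
Definition rowend (n : nat) (lam : seq nat) (T : seq (seq nat)) : seq nat :=
  [seq (if ent lam i == 0 then i else Tent T (ent lam i) i) | i <- iota 1 n].

Definition is_M (n : nat) (lam : seq nat) (a : seq nat) (T : seq (seq nat)) : Prop :=
  [/\ tableau n lam T, rowend n lam T = a &
      forall U, tableau n lam U -> rowend n lam U = a -> tle lam U T].

Definition chain_to_key (n : nat) (lam : seq nat) (B : seq (seq nat)) : seq (seq nat) :=
  [seq nth [::] B (index (zeta lam j) (0 :: R_of n lam ++ [:: n])) | j <- iota 1 (ent lam 1)].

(* Main.v *)
Require Import Defs.
From mathcomp Require Import all_boot zify.
Set Implicit Arguments. Unset Strict Implicit. Unset Printing Implicit Defensive.

(** All three notions are one local condition on consecutive members A = B_h
    and B = B_{h+1} of an R-chain: there are no a in A, b in B \ A and c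
    outside B with b < c < a.  For the chain of a permutation this is
    312-avoidance, for the columns of a key it is gaplessness, and in terms of
    clumps it is rightmost clump deletion.

    Let y_h(i) be the i-th smallest element of B_h.  Under the condition, every
    i <= q_h satisfies y_{h+1}(i) = y_{h+1}(i+1) - 1 or y_{h+1}(i) = y_h(i).
    An entry of a tableau is smaller than the entry below it and at most the
    one to its right, so by induction a tableau with the same row ends as the
    key is bounded by the key, which is therefore the row end max tableau of
    its row end list.

    Conversely, a gapless tuple is the row end list of a chain built one level
    at a time: if x is the first entry of the next carrel, then B_{h+1}
    consists of the entries of that carrel, the elements of B_h below x, and
    the largest missing values below x, as many as the cardinality requires. *)

(** * Counting in strictly increasing sequences; gap-free pairs *)

Definition gap_free (A B : seq nat) : Prop :=
  forall a b c, a \in A -> b \in B -> b \notin A -> b < c < a -> c \in B.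

(** The elements below [x] form an initial segment, so comparing an entry with [x] amounts to
    counting. Positional facts are proved through this translation. *)
Lemma sorted_ltn_nth_lt (s : seq nat) (i x : nat) :
  sorted ltn s -> i < size s -> (nth 0 s i < x) = (i < count (fun y => y < x) s).
Proof.
elim: s i => //= y s IH [|i] /= s_sorted lt_i.
  case: (ltnP y x) => // le_xy; apply/esym/negbTE; rewrite -leqNgt leqn0 add0n.
  rewrite -leqn0 leqNgt -has_count -all_predC.
  apply/allP => z zs /=; move/(order_path_min ltn_trans): s_sorted => /allP /(_ z zs).
  lia.
have s_sorted' := path_sorted s_sorted.
rewrite IH //; case: (ltnP y x) => // le_xy.
suff -> : count (fun y => y < x) s = 0 by lia.
apply/eqP; rewrite -leqn0 leqNgt -has_count -all_predC.
apply/allP => z zs /=; move/(order_path_min ltn_trans): s_sorted => /allP /(_ z zs).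
lia.
Qed.

Lemma sorted_ltn_count_nth (s : seq nat) (i : nat) :
  sorted ltn s -> i < size s -> count (fun y => y < nth 0 s i) s = i.
Proof.
move=> s_sorted lt_i; set c := count _ s.
have le_ci : c <= i by rewrite leqNgt -sorted_ltn_nth_lt // ltnn.
apply/eqP; rewrite eqn_leq le_ci leqNgt; apply/negP => lt_ci.
have lt_c : c < size s by lia.
have := sorted_ltn_nth_lt (nth 0 s i) s_sorted lt_c; rewrite ltnn.
suff -> : nth 0 s c < nth 0 s i by [].
by apply: (sorted_ltn_nth ltn_trans) => //; rewrite inE.
Qed.

Lemma sorted_ltn_eq_size (A B : seq nat) :
  sorted ltn A -> sorted ltn B -> {subset A <= B} -> size B <= size A -> A = B.
Proof.
move=> sA sB sub le_s.
have uA : uniq A := sorted_uniq ltn_trans ltnn sA.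
have [_ eqAB] := uniq_min_size uA sub le_s.
exact: (irr_sorted_eq ltn_trans ltnn).
Qed.

Lemma sub_count_le (A B : seq nat) (P : pred nat) :
  uniq A -> {subset A <= B} -> count P A <= count P B.
Proof.
move=> uA sub; rewrite -!size_filter; apply: uniq_leq_size.
  exact: filter_uniq.
by move=> x; rewrite !mem_filter => /andP [-> /sub].
Qed.

(** Below any bound [B] has at least as many elements as [A], so its [i]-th smallest element cannot
    be larger. *)
Lemma sorted_ltn_sub_nth (A B : seq nat) (i : nat) :
  sorted ltn A -> sorted ltn B -> {subset A <= B} -> i < size A ->
  nth 0 B i <= nth 0 A i.
Proof.
move=> sA sB sub lt_i.
have uA : uniq A := sorted_uniq ltn_trans ltnn sA.
have le_AB := uniq_leq_size uA sub.
rewrite -ltnS sorted_ltn_nth_lt //; last exact: leq_trans lt_i le_AB.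
apply: leq_trans (sub_count_le _ uA sub).
by rewrite -sorted_ltn_nth_lt.
Qed.

(** Let [y] be entry [i] of [B]. If [y.+1] is in [B], it is the next entry. Otherwise suppose that
    entry [i] of [A] exceeds [y], hence also [y.+1], as [A] lies in [B]. By counting, some element
    of [B] up to [y] is missing from [A], and gap-freeness puts [y.+1] in [B], a contradiction. *)
Lemma gap_free_nth (A B : seq nat) (i : nat) :
  sorted ltn A -> sorted ltn B -> {subset A <= B} -> gap_free A B ->
  i.+1 < size B -> i < size A ->
  nth 0 B i.+1 = (nth 0 B i).+1 \/ nth 0 A i = nth 0 B i.
Proof.
move=> sA sB sub gAB ltB ltA.
have uA : uniq A := sorted_uniq ltn_trans ltnn sA.
have ltS : nth 0 B i < nth 0 B i.+1.
  by apply: (sorted_ltn_nth ltn_trans) => //; rewrite inE; lia.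
have ge_AB := sorted_ltn_sub_nth sA sB sub ltA.
have [inB|ninB] := boolP ((nth 0 B i).+1 \in B).
  left; apply/eqP; rewrite eqn_leq ltS andbT leqNgt; apply/negP => gtS.
  have lt_k : index (nth 0 B i).+1 B < size B by rewrite index_mem.
  have := sorted_ltn_count_nth sB lt_k; rewrite nth_index // => cB.
  have := sorted_ltn_nth_lt (nth 0 B i).+1 sB (ltnW ltB).
  have := sorted_ltn_nth_lt (nth 0 B i).+2 sB ltB.
  have := sorted_ltn_nth_lt (nth 0 B i).+1 sB ltB.
  have := sorted_ltn_nth_lt (nth 0 B i).+2 sB lt_k.
  rewrite nth_index // cB; lia.
right; apply/eqP; rewrite eqn_leq ge_AB andbT leqNgt; apply/negP => gtA.
have /allPn [b bB /=] : ~~ all (fun b => (b <= nth 0 B i) ==> (b \in A)) B.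
  apply/negP => /allP allA.
  have cAB : count (fun y => y < (nth 0 B i).+1) B <= count (fun y => y < (nth 0 B i).+1) A.
    rewrite -!size_filter; apply: uniq_leq_size.
      by apply: filter_uniq; apply: sorted_uniq ltn_trans ltnn _ sB.
    by move=> x; rewrite !mem_filter => /andP [le_x xB]; rewrite le_x /=; apply: (implyP (allA x xB)).
  have := sorted_ltn_nth_lt (nth 0 B i).+1 sB (ltnW ltB).
  have := sorted_ltn_nth_lt (nth 0 B i).+1 sA ltA.
  lia.
rewrite negb_imply => /andP [le_b nbA].
have inA : nth 0 A i \in A by rewrite mem_nth.
have neq : nth 0 A i != (nth 0 B i).+1.
  by apply: contraNneq ninB => <-; apply: sub.
by move/negP: ninB; apply; apply: (gAB _ b _ inA bB nbA); lia.
Qed.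

(** * Clumps and rightmost clump deletion *)

Lemma flatten_clumps (s : seq nat) : flatten (clumps s) = s.
Proof.
elim: s => //= x s; case: (clumps s) => [|[|y c] cs] /= <- //.
by case: ifP.
Qed.

Lemma clumps_neq_nil (s : seq nat) : [::] \notin clumps s.
Proof.
elim: s => //= x s; case: (clumps s) => [|[|y c] cs] //=.
by case: ifP => _; rewrite !inE.
Qed.

(** This expresses the maximality of clumps: two distinct runs cannot touch. *)
Lemma clumps_separated (s : seq nat) (k l x y : nat) :
  sorted ltn s -> k < l -> x \in nth [::] (clumps s) k -> y \in nth [::] (clumps s) l ->
  exists2 z, z \notin s & x < z < y.
Proof.
elim: s k l x y => [|w s IH] k l x y; first by rewrite nth_nil.
move=> s_sorted; have s_sorted' := path_sorted s_sorted.
have /allP min_w := order_path_min ltn_trans s_sorted.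
have in_s k' u : u \in nth [::] (clumps s) k' -> u \in s.
  move=> u_in; rewrite -(flatten_clumps s); apply/flattenP.
  have [lt_k|ge_k] := ltnP k' (size (clumps s)).
    by exists (nth [::] (clumps s) k') => //; rewrite mem_nth.
  by move: u_in; rewrite nth_default.
have {}IH k' l' u v : k' < l' -> u \in nth [::] (clumps s) k' ->
    v \in nth [::] (clumps s) l' -> exists2 z, z \notin w :: s & u < z < v.
  move=> lt_kl u_in v_in; have [z nz ltz] := IH _ _ _ _ s_sorted' lt_kl u_in v_in.
  exists z => //; rewrite inE negb_or nz andbT.
  by have := min_w _ (in_s _ _ u_in); rewrite /=; lia.
have := flatten_clumps s.
rewrite /=; case E: (clumps s) in_s IH => [|[|z c] cs] in_s IH eq_s.
- by case: k l => [|k] [|l] //=; rewrite ?nth_nil.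
- by have := clumps_neq_nil s; rewrite E mem_head.
case: eqP => [zE|zN].
  case: k l => [|k] [|l] //= lt_kl; last exact: (IH k.+1 l.+1).
  rewrite inE => /orP [/eqP -> y_in|x_in y_in]; last exact: (IH 0 l.+1).
  have [u nu ltu] := IH 0 l.+1 z y isT (mem_head _ _) y_in.
  by exists u => //; lia.
case: k l => [|k] [|l] //= lt_kl; last exact: (IH k l).
rewrite inE => /eqP -> y_in.
have s_min u : u \in s -> z <= u.
  rewrite -eq_s /= inE => /orP [/eqP -> //|u_in].
  move: s_sorted'; rewrite -eq_s /= => /(order_path_min ltn_trans) /allP /(_ u u_in) /=; lia.
have z_in : z \in s by rewrite -eq_s mem_head.
(* Here [w] is a clump by itself: [w.+1] is missing because the least element [z] of [s] differs
   from it. *)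
exists w.+1.
  rewrite inE negb_or; apply/andP; split; first by lia.
  by apply/negP => /s_min; have := min_w _ z_in; rewrite /=; lia.
have := s_min _ (in_s _ _ y_in); have := min_w _ z_in; rewrite /=; lia.
Qed.

(** Prepending [w] to a clump that starts at [w.+1] opens no gap, so clumps stay intervals
    throughout the recursion. *)
Lemma clumps_convex (s : seq nat) (k x y z : nat) :
  sorted ltn s -> x \in nth [::] (clumps s) k -> y \in nth [::] (clumps s) k ->
  x <= z <= y -> z \in s.
Proof.
elim: s k x y => [|w s IH] k x y; first by rewrite nth_nil.
move=> s_sorted; have s_sorted' := path_sorted s_sorted.
have /allP min_w := order_path_min ltn_trans s_sorted.
have {}IH k' u v : u \in nth [::] (clumps s) k' -> v \in nth [::] (clumps s) k' ->
    u <= z <= v -> z \in w :: s.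
  by move=> u_in v_in le_z; rewrite inE (IH _ _ _ s_sorted' u_in v_in le_z) orbT.
have := flatten_clumps s.
rewrite /=; case E: (clumps s) IH => [|c0 cs] IH eq_s.
  case: k => [|k] /=; rewrite ?nth_nil // !inE => /eqP -> /eqP ->; lia.
case: c0 E IH eq_s => [|u c] E IH eq_s.
  by case: k => [|k] /=; [rewrite !inE => /eqP -> /eqP ->; lia | apply: IH].
case: eqP => [uE|uN].
  case: k => [|k] /=; last exact: (IH k.+1).
  rewrite inE => /orP [/eqP -> |x_in] y_in.
    have [-> _|nzw le_z] := eqVneq z w; first by rewrite mem_head.
    apply: (IH 0 u y) => //=; rewrite ?mem_head //; last by lia.
    move: y_in; rewrite inE => /orP [/eqP y_eq|//]; lia.
  have x_s : x \in s by rewrite -eq_s -[flatten _]/((u :: c) ++ flatten cs) mem_cat x_in.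
  move: y_in; rewrite inE => /orP [/eqP -> |y_in]; last exact: (IH 0).
  by have := min_w _ x_s; rewrite /=; lia.
by case: k => [|k] /=; [rewrite !inE => /eqP -> /eqP ->; lia | apply: IH].
Qed.

Lemma mem_flatten_drop (T : eqType) (cs : seq (seq T)) (k : nat) (x : T) :
  reflect (exists2 l, k <= l & x \in nth [::] cs l) (x \in flatten (drop k cs)).
Proof.
apply: (iffP flattenP) => [[c /(nthP [::]) [i lt_i <-] x_in]|[l le_kl x_in]].
  by exists (k + i); [exact: leq_addr | rewrite -nth_drop].
exists (nth [::] cs l) => //; have [lt_l|ge_l] := ltnP l (size cs).
  by rewrite -(subnKC le_kl) -nth_drop mem_nth // size_drop ltn_sub2r //; exact: leq_ltn_trans lt_l.
by move: x_in; rewrite nth_default.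
Qed.

(** If [b < a] with [b] deleted and [a] kept, then [b] lies in clump [e] or later and [a] in clump
    [e] or earlier, so both lie in clump [e], which is convex. Conversely take for [e] the clump of
    the least deleted [b]: a kept element in a later clump would be separated from [b] by a value
    outside [B]. *)
Lemma clump_deleting_gap_free (A B : seq nat) :
  sorted ltn B -> B != [::] -> {subset A <= B} ->
  (exists e, [/\ 1 <= e <= size (clumps B),
      {subset [seq x <- B | x \notin A] <= flatten (drop e.-1 (clumps B))} &
      {subset flatten (drop e (clumps B)) <= [seq x <- B | x \notin A]}])
  <-> gap_free A B.
Proof.
move=> sB B0 sub; split.
  case=> e [/andP [e_gt0 e_le] sub1 sub2] a b c aA bB nbA lt_bca.
  have /mem_flatten_drop [k le_k b_in] : b \in flatten (drop e.-1 (clumps B)).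
    by apply: sub1; rewrite mem_filter nbA.
  have : a \in flatten (drop 0 (clumps B)) by rewrite drop0 flatten_clumps sub.
  case/mem_flatten_drop => l _ a_in.
  have lt_l : l < e.
    rewrite ltnNge; apply/negP => le_el.
    have : a \in [seq x <- B | x \notin A] by apply/sub2/mem_flatten_drop; exists l.
    by rewrite mem_filter aA.
  have [lt_lk|le_kl] := ltnP l k.
    by have [z _] := clumps_separated sB lt_lk a_in b_in; lia.
  have eq_kl : k = l by lia.
  by rewrite -eq_kl in a_in; apply: (clumps_convex sB b_in a_in); lia.
move=> gAB.
have cs_gt0 : 0 < size (clumps B).
  rewrite lt0n size_eq0; apply: contraNneq B0 => cs0.
  by rewrite -(flatten_clumps B) cs0.
have [/hasP [b0 b0B nb0A]|/hasPn noD] := boolP (has (fun x => x \notin A) B); last first.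
  exists (size (clumps B)); split; first by rewrite cs_gt0 leqnn.
    by move=> x; rewrite mem_filter => /andP [nxA /noD]; rewrite nxA.
  by rewrite drop_size.
have exD : exists b, (b \in B) && (b \notin A) by exists b0; rewrite b0B.
case: (ex_minnP exD) => b /andP [bB nbA] b_min.
have : b \in flatten (drop 0 (clumps B)) by rewrite drop0 flatten_clumps.
case/mem_flatten_drop => k _ b_in.
have lt_k : k < size (clumps B).
  by rewrite ltnNge; apply/negP => ge_k; rewrite nth_default in b_in.
exists k.+1; split=> //=.
  move=> d; rewrite mem_filter => /andP [ndA dB].
  have : d \in flatten (drop 0 (clumps B)) by rewrite drop0 flatten_clumps.
  case/mem_flatten_drop => l _ d_in; apply/mem_flatten_drop; exists l => //.
  rewrite leqNgt; apply/negP => lt_lk.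
  have [z _] := clumps_separated sB lt_lk d_in b_in.
  by have := b_min d; rewrite dB ndA => /(_ isT); lia.
move=> y /mem_flatten_drop [l lt_kl y_in].
have yB : y \in B.
  rewrite -(flatten_clumps B) -[clumps B]drop0.
  by apply/mem_flatten_drop; exists l.
rewrite mem_filter yB andbT; apply/negP => yA.
have [z /negP nzB lt_bzy] := clumps_separated sB lt_kl b_in y_in.
by apply: nzB; apply: (gAB y b).
Qed.

(** * Partitions, carrels and column lengths *)

Lemma sorted_geq_count (s : seq nat) (i j : nat) :
  sorted geq s -> i < size s -> (i < count (fun x => j <= x) s) = (j <= nth 0 s i).
Proof.
have geqT : transitive geq by move=> x y z /= le_xy le_zx; apply: leq_trans le_zx le_xy.
elim: s i => //= y s IH [|i] /= s_sorted lt_i.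
  case: (leqP j y) => // lt_yj; apply/negbTE; rewrite -leqNgt leqn0 add0n.
  rewrite -leqn0 leqNgt -has_count -all_predC.
  apply/allP => z zs /=; move/(order_path_min geqT): s_sorted => /allP /(_ z zs) /=.
  lia.
rewrite -IH ?(path_sorted s_sorted) //; case: (leqP j y) => // lt_yj.
suff -> : count (fun x => j <= x) s = 0 by lia.
apply/eqP; rewrite -leqn0 leqNgt -has_count -all_predC.
apply/allP => z zs /=; move/(order_path_min geqT): s_sorted => /allP /(_ z zs) /=.
lia.
Qed.

(** This isolates the properties of [R_of n lam] on which the arguments about chains, tuples and
    permutations rest. *)
Definition descent_set (n : nat) (R : seq nat) : Prop :=
  [/\ 0 < n, sorted ltn R & forall q, q \in R -> 0 < q < n].

Lemma qq_sorted (n : nat) (R : seq nat) :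
  descent_set n R -> sorted ltn (0 :: R ++ [:: n]).
Proof.
case=> n0 sR bR /=; rewrite path_sortedE; last exact: ltn_trans.
rewrite all_cat /= n0 !andbT; apply/andP; split; first by apply/allP => q /bR /andP [].
move: sR; rewrite !(sorted_pairwise ltn_trans) pairwise_cat /= => ->.
by rewrite !andbT allrel1r; apply/allP => q /bR /andP [].
Qed.

Lemma qq_last (n : nat) (R : seq nat) : qq n R (size R).+1 = n.
Proof. by rewrite /qq /= nth_cat ltnn subnn. Qed.

Lemma qq_ltn (n : nat) (R : seq nat) (h k : nat) :
  descent_set n R -> h < k -> k <= (size R).+1 -> qq n R h < qq n R k.
Proof.
move=> dR lt_hk le_k; apply: (sorted_ltn_nth ltn_trans 0 (qq_sorted dR)) => //;
  by rewrite inE /= size_cat /=; lia.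
Qed.

Lemma qq_leq (n : nat) (R : seq nat) (h k : nat) :
  descent_set n R -> h <= k -> k <= (size R).+1 -> qq n R h <= qq n R k.
Proof.
move=> dR; rewrite leq_eqVlt => /orP [/eqP -> //|lt_hk le_k].
exact: ltnW (qq_ltn dR lt_hk le_k).
Qed.

Lemma index_qq (n : nat) (R : seq nat) (h : nat) :
  descent_set n R -> h <= (size R).+1 -> index (qq n R h) (0 :: R ++ [:: n]) = h.
Proof.
move=> dR le_h; apply: index_uniq; first by rewrite /= size_cat /=; lia.
exact: sorted_uniq ltn_trans ltnn _ (qq_sorted dR).
Qed.

Lemma carrel_eq (n : nat) (R : seq nat) (h i : nat) :
  descent_set n R -> h <= size R -> qq n R h < i <= qq n R h.+1 -> carrel R i = h.+1.
Proof.
move=> dR le_h /andP [lt_qi le_iq]; have sF := qq_sorted dR.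
have le_qn : qq n R h.+1 <= n by rewrite -{2}(qq_last n R) qq_leq.
have sz : size (0 :: R ++ [:: n]) = (size R).+2 by rewrite /= size_cat addn1.
have := @sorted_ltn_nth_lt _ h i sF; have := @sorted_ltn_nth_lt _ h.+1 i sF.
rewrite -!/(qq n R _) sz /= count_cat /= /carrel.
by move=> /(_ ltac:(lia)) E1 /(_ ltac:(lia)) E2; lia.
Qed.

Lemma carrel_bounds (n : nat) (R : seq nat) (i : nat) :
  descent_set n R -> 1 <= i <= n ->
  1 <= carrel R i <= (size R).+1 /\ qq n R (carrel R i).-1 < i <= qq n R (carrel R i).
Proof.
move=> dR /andP [i_gt0 le_in]; have sF := qq_sorted dR.
have sz : size (0 :: R ++ [:: n]) = (size R).+2 by rewrite /= size_cat addn1.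
have := count_size (fun q => q < i) R; rewrite /carrel; set c := count _ R => le_c.
have := @sorted_ltn_nth_lt _ c i sF; have := @sorted_ltn_nth_lt _ c.+1 i sF.
rewrite -!/(qq n R _) sz /= count_cat /= -/c.
by move=> /(_ ltac:(lia)) E1 /(_ ltac:(lia)) E2; lia.
Qed.

Lemma R_of_descent_set (n : nat) (lam : seq nat) : 0 < n -> descent_set n (R_of n lam).
Proof.
move=> n0; split=> //; first by apply: sorted_filter (iota_ltn_sorted _ _); apply: ltn_trans.
by move=> q; rewrite mem_filter mem_iota; lia.
Qed.

Lemma zeta_ge (n : nat) (lam : seq nat) (i j : nat) :
  is_partition n lam -> 1 <= i <= n -> (i <= zeta lam j) = (j <= ent lam i).
Proof.
case=> sz slam le_i; rewrite /zeta /ent -sorted_geq_count //; last by lia.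
by case: i le_i.
Qed.

Lemma zeta_le (n : nat) (lam : seq nat) (j : nat) : is_partition n lam -> zeta lam j <= n.
Proof. by case=> <- _; apply: count_size. Qed.

Lemma zeta_anti (lam : seq nat) (j k : nat) : j <= k -> zeta lam k <= zeta lam j.
Proof. by move=> le_jk; apply: sub_count => x /=; apply: leq_trans. Qed.

Lemma zeta_gt0 (n : nat) (lam : seq nat) (j : nat) :
  0 < n -> is_partition n lam -> j <= ent lam 1 -> 0 < zeta lam j.
Proof. by move=> n0 plam le_j; rewrite (zeta_ge _ plam). Qed.

Lemma zeta_mem (n : nat) (lam : seq nat) (j : nat) :
  0 < n -> is_partition n lam -> 1 <= j <= ent lam 1 -> zeta lam j \in R_of n lam ++ [:: n].
Proof.
move=> n0 plam j_in; rewrite mem_cat mem_seq1 mem_filter mem_iota.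
have := zeta_le j plam; rewrite leq_eqVlt => /orP [->|lt_n]; first by rewrite orbT.
have := zeta_gt0 n0 plam (proj2 (andP j_in)) => z_gt0.
apply/orP; left; apply/andP; split; last by lia.
by apply/hasP; exists j => //; rewrite mem_iota; lia.
Qed.

(** The index [h] for which [qq n R h] is the length of column [j], computed as in [chain_to_key].
    Levels decrease weakly from left to right. *)
Definition col_level (n : nat) (lam : seq nat) (j : nat) : nat :=
  index (zeta lam j) (0 :: R_of n lam ++ [:: n]).

Lemma qq_col_level (n : nat) (lam : seq nat) (j : nat) :
  0 < n -> is_partition n lam -> 1 <= j <= ent lam 1 ->
  qq n (R_of n lam) (col_level n lam j) = zeta lam j.
Proof. by move=> n0 plam j_in; rewrite /qq nth_index // inE zeta_mem ?orbT. Qed.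

Lemma col_level_bounds (n : nat) (lam : seq nat) (j : nat) :
  0 < n -> is_partition n lam -> 1 <= j <= ent lam 1 ->
  1 <= col_level n lam j <= (size (R_of n lam)).+1.
Proof.
move=> n0 plam j_in; have z_gt0 := zeta_gt0 n0 plam (proj2 (andP j_in)).
have := zeta_mem n0 plam j_in; rewrite -index_mem size_cat /= addn1 => lt_i.
by rewrite /col_level /=; case: eqP; lia.
Qed.

(** The top level is left out, since columns of length [n] need not exist. *)
Lemma col_of_level (n : nat) (lam : seq nat) (h : nat) :
  1 <= h <= size (R_of n lam) ->
  exists2 j, 1 <= j <= ent lam 1 & zeta lam j = qq n (R_of n lam) h.
Proof.
case: h => // h /= lt_h.
have : qq n (R_of n lam) h.+1 \in R_of n lam by rewrite /qq /= nth_cat lt_h mem_nth.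
rewrite mem_filter => /andP [/hasP [j]]; rewrite mem_iota => j_in /eqP jE _.
by exists j => //; lia.
Qed.

(** Column [ent lam i] is the last one meeting row [i], so its length is the smallest column length
    that is at least [i]: the right end of the carrel of [i]. *)
Lemma zeta_row_end (n : nat) (lam : seq nat) (i : nat) :
  0 < n -> is_partition n lam -> 1 <= i <= n -> 0 < ent lam i ->
  ent lam i <= ent lam 1 /\ zeta lam (ent lam i) = qq n (R_of n lam) (carrel (R_of n lam) i).
Proof.
move=> n0 plam i_in li_gt0; have dR := R_of_descent_set lam n0.
have i_le : i <= zeta lam (ent lam i) by rewrite (zeta_ge _ plam).
have le_1 : ent lam i <= ent lam 1 by rewrite -(zeta_ge _ plam) //; lia.
split=> //; have j_in : 1 <= ent lam i <= ent lam 1 by lia.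
have [/andP [c_gt0 c_le] /andP [_ i_le_c]] := carrel_bounds dR i_in.
have := col_level_bounds n0 plam j_in; have := qq_col_level n0 plam j_in.
set h := col_level _ _ _; set c := carrel _ _ in c_gt0 c_le i_le_c * => <- /andP [h_gt0 h_le].
have lt_c : qq n (R_of n lam) c.-1 < i by case: (carrel_bounds dR i_in) => _ /andP [].
congr qq; apply/eqP; rewrite eqn_leq; apply/andP; split.
  rewrite leqNgt; apply/negP => lt_ch.
  have [j jE zE] := @col_of_level n lam c ltac:(lia).
  have le_j : j <= ent lam i by rewrite -(zeta_ge _ plam) // zE.
  have := zeta_anti lam le_j; rewrite zE -(qq_col_level n0 plam j_in) -/h.
  by rewrite leqNgt qq_ltn.
rewrite leqNgt; apply/negP => lt_hc.
have : qq n (R_of n lam) h <= qq n (R_of n lam) c.-1 by apply: qq_leq => //; lia.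
by rewrite /h qq_col_level //; lia.
Qed.

Lemma carrel_empty_row (n : nat) (lam : seq nat) (i : nat) :
  is_partition n lam -> 1 <= i <= n -> ent lam i = 0 ->
  carrel (R_of n lam) i = (size (R_of n lam)).+1.
Proof.
move=> plam i_in li0; congr _.+1; apply/eqP; rewrite -all_count.
apply/allP => q; rewrite mem_filter => /andP [/hasP [j]].
rewrite mem_iota => j_in /eqP <- _; rewrite ltnNge (zeta_ge _ plam) // li0; lia.
Qed.

(** * R-chains and their keys *)

Lemma Rchain_sub (n : nat) (R : seq nat) (B : seq (seq nat)) (h k : nat) :
  Rchain n R B -> h <= k -> k <= (size R).+1 -> {subset nth [::] B h <= nth [::] B k}.
Proof.
case=> _ _ _ subB _; elim: k => [|k IH]; first by rewrite leqn0 => /eqP -> _ x.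
rewrite leq_eqVlt => /orP [/eqP -> _ x //|lt_hk] le_k x x_in.
by apply: (proj1 (subB k _)) => //; apply: IH => //; lia.
Qed.

Lemma Rchain_bounds (n : nat) (R : seq nat) (B : seq (seq nat)) (h x : nat) :
  Rchain n R B -> h <= (size R).+1 -> x \in nth [::] B h -> 1 <= x <= n.
Proof.
move=> cB le_h /(Rchain_sub cB le_h (leqnn _)); case: cB => _ _ -> _ _.
by rewrite mem_iota; lia.
Qed.

Definition chain_gap_free (R : seq nat) (B : seq (seq nat)) : Prop :=
  forall h, h <= size R -> gap_free (nth [::] B h) (nth [::] B h.+1).

(* The extreme levels impose nothing: the lower set of the first pair is empty
   and the upper set of the last pair is all of [n]. *)
Lemma chain_gap_free_inner (n : nat) (R : seq nat) (B : seq (seq nat)) :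
  Rchain n R B ->
  (forall h, 1 <= h <= (size R).-1 -> gap_free (nth [::] B h) (nth [::] B h.+1)) ->
  chain_gap_free R B.
Proof.
move=> cB gB h le_h; have [h0|h_gt0] := posnP h.
  by move=> a b c; rewrite h0; case: cB => _ ->.
have [lt_h|ge_h] := ltnP h (size R); first by apply: gB; lia.
have hE : h = size R by lia.
move=> a b c aA bB _ lt_c.
have := Rchain_bounds cB (leqW le_h) aA; have := Rchain_bounds cB _ bB.
rewrite hE => /(_ (leqnn _)); case: cB => _ _ -> _ _.
by rewrite mem_iota; lia.
Qed.

Lemma RCD_gap_free (n : nat) (R : seq nat) (B : seq (seq nat)) :
  descent_set n R -> Rchain n R B -> (RCD n R B <-> chain_gap_free R B).
Proof.
move=> dR cB; have [[szB sB] _ _ _ sizes] := cB.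
have local h : h <= size R -> (exists e, [/\ 1 <= e <= size (clumps (nth [::] B h.+1)),
      {subset [seq x <- nth [::] B h.+1 | x \notin nth [::] B h]
         <= flatten (drop e.-1 (clumps (nth [::] B h.+1)))} &
      {subset flatten (drop e (clumps (nth [::] B h.+1)))
         <= [seq x <- nth [::] B h.+1 | x \notin nth [::] B h]}])
   <-> gap_free (nth [::] B h) (nth [::] B h.+1).
  move=> le_h; apply: clump_deleting_gap_free; first exact: sB.
    by rewrite -size_eq0 sizes // -lt0n (leq_ltn_trans _ (qq_ltn dR (ltnSn h) _)).
  exact: Rchain_sub cB _ _.
split=> [rcd|gB h h_in]; last by apply/local; [lia | apply: gB; lia].
by apply: (chain_gap_free_inner cB) => h h_in; apply/local; [lia | apply: rcd; lia].
Qed.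

Lemma col_key (n : nat) (lam : seq nat) (B : seq (seq nat)) (j : nat) :
  1 <= j <= ent lam 1 -> col (chain_to_key n lam B) j = nth [::] B (col_level n lam j).
Proof.
move=> j_in; rewrite /col (nth_map 0) ?size_iota; last by lia.
by rewrite nth_iota; [congr (nth _ _ (col_level _ _ _)); lia | lia].
Qed.

Lemma col_level_anti (n : nat) (lam : seq nat) (l j : nat) :
  0 < n -> is_partition n lam -> 1 <= l <= j -> j <= ent lam 1 ->
  col_level n lam j <= col_level n lam l.
Proof.
move=> n0 plam le_lj le_j; have dR := R_of_descent_set lam n0.
have j_in : 1 <= j <= ent lam 1 by lia.
have l_in : 1 <= l <= ent lam 1 by lia.
rewrite leqNgt; apply/negP => lt_lj.
have := qq_ltn dR lt_lj (proj2 (andP (col_level_bounds n0 plam j_in))).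
rewrite !qq_col_level // ltnNge zeta_anti //; lia.
Qed.

Lemma col_levelP (n : nat) (lam : seq nat) (h j : nat) :
  0 < n -> is_partition n lam -> h <= (size (R_of n lam)).+1 ->
  zeta lam j = qq n (R_of n lam) h -> col_level n lam j = h.
Proof.
by move=> n0 plam le_h zE; rewrite /col_level zE index_qq //; apply: R_of_descent_set.
Qed.

Lemma Rchain_lam_key (n : nat) (lam : seq nat) (B : seq (seq nat)) :
  0 < n -> is_partition n lam -> Rchain n (R_of n lam) B ->
  lam_key n lam (chain_to_key n lam B).
Proof.
move=> n0 plam cB; have [[szB sB] _ _ _ sizes] := cB.
have key_sub l j : 1 <= l <= j -> j <= ent lam 1 ->
    {subset col (chain_to_key n lam B) j <= col (chain_to_key n lam B) l}.
  move=> le_lj le_j; have l_in : 1 <= l <= ent lam 1 by lia.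
  rewrite !col_key //; last by lia.
  apply: (Rchain_sub cB); first exact: col_level_anti.
  by case/andP: (col_level_bounds n0 plam l_in).
have cols j : 1 <= j <= ent lam 1 -> [/\ size (col (chain_to_key n lam B) j) = zeta lam j,
    sorted ltn (col (chain_to_key n lam B) j) &
    forall x, x \in col (chain_to_key n lam B) j -> 1 <= x <= n].
  move=> j_in; have /andP [_ le_r] := col_level_bounds n0 plam j_in.
  rewrite col_key //; split; [by rewrite sizes // qq_col_level | exact: sB | ].
  by move=> x; apply: (Rchain_bounds cB).
split; last exact: key_sub.
split=> //; first by rewrite size_map size_iota.
move=> j i j_in i_in; rewrite /Tent /ent.
have [|sz s1 _] := cols j; first by lia.
have [|sz' s2 _] := cols j.+1; first by lia.
by apply: sorted_ltn_sub_nth => //; [apply: key_sub; lia | rewrite sz'; lia].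
Qed.

Lemma mem_vals_len (n : nat) (lam : seq nat) (B : seq (seq nat)) (h : nat) :
  0 < n -> is_partition n lam -> 1 <= h <= size (R_of n lam) ->
  vals_len lam (chain_to_key n lam B) (qq n (R_of n lam) h) =i nth [::] B h.
Proof.
move=> n0 plam h_in x; apply/flatten_mapP/idP.
  case=> j; rewrite mem_filter mem_iota => /andP [/eqP zE j_in].
  rewrite col_key; last by lia.
  by rewrite (col_levelP n0 plam _ zE) //; lia.
have [j j_in zE] := col_of_level h_in; move=> x_in; exists j.
  by rewrite mem_filter zE eqxx mem_iota; lia.
by rewrite col_key // (col_levelP n0 plam _ zE) //; lia.
Qed.

(** [gapless_key] tests only the least new value and the greatest old one, but these span every
    interval from a new value up to an old one. In the other direction the two end points lie in the
    upper set already, and gap-freeness supplies the values strictly between. *)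
Lemma gapless_key_gap_free (n : nat) (lam : seq nat) (B : seq (seq nat)) :
  0 < n -> is_partition n lam -> Rchain n (R_of n lam) B ->
  (gapless_key n lam (chain_to_key n lam B) <-> chain_gap_free (R_of n lam) B).
Proof.
move=> n0 plam cB; split.
  case=> _ gK; apply: (chain_gap_free_inner cB) => h h_in a b c aA bB nbA lt_c.
  have h_in1 : 1 <= h <= size (R_of n lam) by lia.
  have h_in2 : 1 <= h.+1 <= size (R_of n lam) by lia.
  have exD : exists b, (b \in nth [::] B h.+1) && (b \notin nth [::] B h).
    by exists b; rewrite bB.
  case: (ex_minnP exD) => b0 /andP [b0B nb0A] b0_min.
  have exA : exists a, a \in nth [::] B h by exists a.
  have ubA y : y \in nth [::] B h -> y <= n.
    have le_h : h <= (size (R_of n lam)).+1 by lia.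
    by move=> /(Rchain_bounds cB le_h) /andP [].
  case: (ex_maxnP exA ubA) => m mA m_max.
  have [j j_in zE] := col_of_level h_in2.
  have le_b0 : b0 <= b by apply: b0_min; rewrite bB.
  have le_m := m_max _ aA.
  have memh := mem_vals_len B n0 plam h_in1; have memh1 := mem_vals_len B n0 plam h_in2.
  have : c \in col (chain_to_key n lam B) j.
    apply: (gK h h_in b0 m) => //; rewrite ?memh ?memh1 //; try lia.
      by move=> x; rewrite memh memh1 => xB nxA; apply: b0_min; rewrite xB.
    by move=> x; rewrite memh; apply: m_max.
  by rewrite col_key // (col_levelP n0 plam _ zE) //; lia.
move=> gB; split; first exact: Rchain_lam_key.
move=> R h h_in Vh Vh1 b m bV nbV b_min mV m_max le_bm j j_in zE x x_in.
have memh : Vh =i nth [::] B h by apply: mem_vals_len => //; rewrite -/R; lia.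
have memh1 : Vh1 =i nth [::] B h.+1 by apply: mem_vals_len => //; rewrite -/R; lia.
rewrite memh1 in bV; rewrite memh in nbV; rewrite memh in mV.
rewrite col_key // (col_levelP n0 plam _ zE); last by rewrite -/R; lia.
have [-> //|nxb] := eqVneq x b.
have [->|nxm] := eqVneq x m.
  by apply: (Rchain_sub cB (leqnSn h)) => //; rewrite -/R; lia.
by apply: (gB h _ m b) => //; rewrite -/R; lia.
Qed.

Lemma Rchain_eq (n : nat) (R : seq nat) (B B' : seq (seq nat)) :
  Rchain n R B -> Rchain n R B' ->
  (forall h, 1 <= h <= size R -> nth [::] B h = nth [::] B' h) -> B = B'.
Proof.
move=> [[szB _] B0 Bn _ _] [[szB' _] B'0 B'n _ _] eqB.
apply: (@eq_from_nth _ [::]); first by rewrite szB szB'.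
move=> h; rewrite szB => lt_h; have [->|h_gt0] := posnP h; first by rewrite B0 B'0.
have [lt_r|ge_r] := leqP h (size R); first by apply: eqB; lia.
have -> : h = (size R).+1 by lia.
by rewrite Bn B'n.
Qed.

(** Levels 1 to [size R] all occur as columns of the key, and the extreme levels are the same in
    every chain. *)
Lemma chain_to_key_inj (n : nat) (lam : seq nat) (B B' : seq (seq nat)) :
  0 < n -> is_partition n lam -> Rchain n (R_of n lam) B -> Rchain n (R_of n lam) B' ->
  chain_to_key n lam B = chain_to_key n lam B' -> B = B'.
Proof.
move=> n0 plam cB cB' eqK; apply: (Rchain_eq cB cB') => h h_in.
have [j j_in zE] := col_of_level h_in.
have := col_key n B j_in; rewrite eqK col_key // (col_levelP n0 plam _ zE) //; lia.
Qed.

Lemma sorted_ltn_full (n : nat) (s : seq nat) :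
  sorted ltn s -> size s = n -> (forall x, x \in s -> 1 <= x <= n) -> s = iota 1 n.
Proof.
move=> ss sz bs; apply: sorted_ltn_eq_size; rewrite ?size_iota ?sz //.
  exact: iota_ltn_sorted.
by move=> x /bs; rewrite mem_iota; lia.
Qed.

(** Nested columns of equal length coincide, so a level may be read off any column of its length.
    The top level is set to [[n]] whether or not such a column exists. *)
Lemma lam_key_chain (n : nat) (lam : seq nat) (Y : seq (seq nat)) :
  0 < n -> is_partition n lam -> lam_key n lam Y ->
  exists2 B, Rchain n (R_of n lam) B & chain_to_key n lam B = Y.
Proof.
move=> n0 plam [[szY cols rows] nested].
set R := R_of n lam; have dR : descent_set n R := R_of_descent_set lam n0.
(* [find] counts from 0 and [iota 1] starts at 1, hence the successor. *)
pose jcol h := (find (fun j => zeta lam j == qq n R h) (iota 1 (ent lam 1))).+1.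
have jcolP h : 1 <= h <= size R -> 1 <= jcol h <= ent lam 1 /\ zeta lam (jcol h) = qq n R h.
  move=> h_in; have [j j_in zE] := col_of_level h_in.
  have hasj : has (fun j => zeta lam j == qq n R h) (iota 1 (ent lam 1)).
    by apply/hasP; exists j; rewrite ?zE // mem_iota; lia.
  have := hasj; rewrite has_find size_iota => lt_f; split; first by rewrite /jcol; lia.
  by have /eqP := nth_find 0 hasj; rewrite nth_iota // add1n.
pose F h := if h == 0 then [::] else if h <= size R then col Y (jcol h) else iota 1 n.
have FP h : h <= (size R).+1 -> [/\ sorted ltn (F h), size (F h) = qq n R h &
    forall x, x \in F h -> 1 <= x <= n].
  move=> le_h; rewrite /F; case: eqP => [->//|h_neq0].
  case: (leqP h (size R)) => [le_hr|lt_rh].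
    have [|j_in zE] := jcolP h; first by lia.
    by have [sz sc bc] := cols _ j_in; split=> //; rewrite sz.
  split; [exact: iota_ltn_sorted | | by move=> x; rewrite mem_iota; lia].
  by rewrite size_iota (_ : h = (size R).+1) ?qq_last //; lia.
have col_eq j k : 1 <= j <= ent lam 1 -> 1 <= k <= ent lam 1 -> zeta lam j = zeta lam k ->
    col Y j = col Y k.
  wlog le_jk : j k / j <= k.
    move=> W j_in k_in zE; case/orP: (leq_total j k) => le_jk; first exact: W.
    by apply/esym/W.
  move=> j_in k_in zE; apply/esym.
  have [sz1 s1 _] := cols j j_in; have [sz2 s2 _] := cols k k_in.
  by apply: sorted_ltn_eq_size; rewrite ?sz1 ?sz2 ?zE //; apply: nested; lia.
have nthF h : h <= (size R).+1 -> nth [::] (mkseq F (size R).+2) h = F h.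
  by move=> le_h; rewrite nth_mkseq.
have subF h : h <= size R -> {subset F h <= F h.+1}.
  move=> le_h; have [->|h_gt0] := posnP h; first by [].
  have [lt_h|ge_h] := ltnP h (size R).
    have [|j1 z1] := jcolP h; first by lia.
    have [|j2 z2] := jcolP h.+1; first by lia.
    rewrite /F (gtn_eqF h_gt0) le_h lt_h /=; apply: nested; last by lia.
    apply/andP; split; first by lia.
    rewrite leqNgt; apply/negP => /ltnW /(zeta_anti lam).
    by rewrite z1 z2 leqNgt qq_ltn //; lia.
  move=> x x_in; have [_ _ /(_ x x_in) bx] := FP h ltac:(lia).
  by rewrite /F ltnNge ge_h /= mem_iota; lia.
exists (mkseq F (size R).+2).
  split; rewrite ?nthF //.
  - split; first by rewrite size_mkseq.
    by move=> h le_h; rewrite nthF //; case: (FP h le_h).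
  - by rewrite /F /= ltnn.
  - move=> h le_h; rewrite !nthF //; last by lia.
    split; first exact: subF.
    have [_ sz1 _] := FP h ltac:(lia); have [_ sz2 _] := FP h.+1 ltac:(lia).
    apply/eqP => /(congr1 size); rewrite sz1 sz2; have := qq_ltn dR (ltnSn h) le_h; lia.
  - by move=> h le_h; rewrite nthF //; case: (FP h le_h).
apply: (@eq_from_nth _ [::]); first by rewrite size_map size_iota szY.
move=> k; rewrite size_map size_iota => lt_k.
have k_in : 1 <= k.+1 <= ent lam 1 by lia.
rewrite -[RHS]/(col Y k.+1) -[LHS]/(col _ k.+1) col_key //.
have /andP [l_gt0 l_le] := col_level_bounds n0 plam k_in.
have zE := qq_col_level n0 plam k_in.
rewrite nthF // /F (gtn_eqF l_gt0); case: leqP => [le_r|gt_r].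
  have [|j_in zE'] := jcolP (col_level n lam k.+1); first by rewrite l_gt0.
  by apply: col_eq => //; rewrite zE' -zE.
have [sz sc bc] := cols _ k_in; apply/esym/sorted_ltn_full => //.
by rewrite sz -zE (_ : col_level _ _ _ = (size R).+1) ?qq_last //; apply/eqP; rewrite eqn_leq l_le.
Qed.

(** * Row end lists of the keys of chains *)

Definition chain_tuple (n : nat) (R : seq nat) (B : seq (seq nat)) : seq nat :=
  [seq ent (nth [::] B (carrel R i)) i | i <- iota 1 n].

Lemma ent_map_iota (f : nat -> nat) (n i : nat) :
  1 <= i <= n -> ent [seq f i | i <- iota 1 n] i = f i.
Proof.
move=> i_in; rewrite /ent (nth_map 0) ?size_iota; last by lia.
by rewrite nth_iota; [congr f; lia | lia].
Qed.

Lemma chain_tupleE (n : nat) (R : seq nat) (B : seq (seq nat)) (h i : nat) :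
  descent_set n R -> h <= size R -> qq n R h < i <= qq n R h.+1 ->
  ent (chain_tuple n R B) i = ent (nth [::] B h.+1) i.
Proof.
move=> dR le_h i_in.
have le_n : qq n R h.+1 <= n by rewrite -{2}(qq_last n R) qq_leq.
by rewrite ent_map_iota ?(carrel_eq dR le_h i_in) //; lia.
Qed.

Lemma rowend_key (n : nat) (lam : seq nat) (B : seq (seq nat)) :
  0 < n -> is_partition n lam -> Rchain n (R_of n lam) B ->
  rowend n lam (chain_to_key n lam B) = chain_tuple n (R_of n lam) B.
Proof.
move=> n0 plam cB; apply/eq_in_map => i; rewrite mem_iota => i_in.
have {}i_in : 1 <= i <= n by lia.
(* An empty row belongs to the last carrel, where the level is all of [[n]]; its [i]-th element is
   [i], in agreement with the latent column. *)
case: eqP => [li0|/eqP li_neq0].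
  rewrite (carrel_empty_row plam i_in li0); case: cB => _ _ -> _ _.
  by rewrite /ent nth_iota; lia.
have [le_1 zE] := zeta_row_end n0 plam i_in (ltac:(lia) : 0 < ent lam i).
have dR := R_of_descent_set lam n0.
have [/andP [_ c_le] _] := carrel_bounds dR i_in.
rewrite /Tent col_key; last by lia.
by rewrite (col_levelP n0 plam c_le zE).
Qed.

Lemma sorted_ltn_nth_ge (s : seq nat) (i : nat) :
  sorted ltn s -> (forall x, x \in s -> 0 < x) -> i < size s -> i < nth 0 s i.
Proof.
move=> ss pos_s; elim: i => [|i IH] lt_i; first by apply/pos_s/mem_nth.
apply: leq_ltn_trans (IH (ltnW lt_i)) _.
by apply: (sorted_ltn_nth ltn_trans) => //; rewrite inE; lia.
Qed.

(* The elements of [B] from position [size A] on are as many as those of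
   [B \ A], so a gap between that position and the maximum of [A] would leave
   an element of [B \ A] below the gap. *)
Lemma gap_free_interval (A B : seq nat) (m x : nat) :
  sorted ltn A -> sorted ltn B -> {subset A <= B} -> gap_free A B ->
  size A < size B -> m \in A -> nth 0 B (size A) <= x <= m -> x \in B.
Proof.
move=> sA sB sub gAB ltAB mA x_in.
have uA : uniq A := sorted_uniq ltn_trans ltnn sA.
have yB : nth 0 B (size A) \in B by rewrite mem_nth.
have [-> //|nxy] := eqVneq x (nth 0 B (size A)).
have [->|nxm] := eqVneq x m; first exact: sub.
have /allPn [b bB /=] : ~~ all (fun b => (b <= nth 0 B (size A)) ==> (b \in A)) B.
  apply/negP => /allP allA.
  have : count (fun y => y < (nth 0 B (size A)).+1) B <= size A.
    rewrite -size_filter; apply: uniq_leq_size.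
      by apply: filter_uniq; apply: sorted_uniq ltn_trans ltnn _ sB.
    by move=> z; rewrite !mem_filter => /andP [le_z zB]; apply: (implyP (allA z zB)).
  by rewrite leqNgt -sorted_ltn_nth_lt // ltnS leqnn.
rewrite negb_imply => /andP [le_b nbA].
by apply: (gAB m b) => //; lia.
Qed.

(** An interval of values contained in [s] leaves no room for other entries, hence occupies
    consecutive positions. *)
Lemma sorted_ltn_interval (s : seq nat) (i m t : nat) :
  sorted ltn s -> i < size s -> nth 0 s i + t <= m ->
  (forall x, nth 0 s i <= x <= m -> x \in s) ->
  i + t < size s /\ nth 0 s (i + t) = nth 0 s i + t.
Proof.
move=> ss lt_i; elim: t => [|t IH] le_m int; first by rewrite !addn0.
have [|lt_t nthE] := IH _ int; first by lia.
have x_in : nth 0 s i + t.+1 \in s by apply: int; lia.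
have lt_k : index (nth 0 s i + t.+1) s < size s by rewrite index_mem.
have cE := sorted_ltn_count_nth ss lt_k; rewrite nth_index // in cE.
have := sorted_ltn_nth_lt (nth 0 s i + t.+1) ss lt_t; rewrite nthE cE => lt_it.
have lt_it' : i + t < index (nth 0 s i + t.+1) s by lia.
have lt_t1 : i + t.+1 < size s by lia.
split=> //; have := sorted_ltn_nth_lt (nth 0 s i + t.+1) ss lt_t1; rewrite cE.
have : nth 0 s (i + t) < nth 0 s (i + t.+1).
  by apply: (sorted_ltn_nth ltn_trans) => //; rewrite ?inE; lia.
have [->|neq] := eqVneq (i + t.+1) (index (nth 0 s i + t.+1) s); first by rewrite nth_index.
have : nth 0 s (i + t.+1) < nth 0 s (index (nth 0 s i + t.+1) s).
  by apply: (sorted_ltn_nth ltn_trans) => //; rewrite ?inE; lia.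
by rewrite nth_index // nthE; lia.
Qed.

Lemma sorted_ltn_le_last (s : seq nat) (x : nat) :
  sorted ltn s -> x \in s -> x <= ent s (size s).
Proof.
move=> ss x_in; have lt_x : index x s < size s by rewrite index_mem.
rewrite -{1}(nth_index 0 x_in) /ent.
apply: (sorted_leq_nth leq_trans leqnn 0); rewrite ?inE; try lia.
by move: ss; rewrite ltn_sorted_uniq_leq => /andP [].
Qed.

(** At a descent let [m] be the greatest element of the lower level and [x] the first entry of the
    next carrel. All values from [x] to [m] lie in the upper level, so they fill consecutive
    positions there, and this is the run demanded of a gapless tuple. *)
Lemma chain_tuple_gapless (n : nat) (R : seq nat) (B : seq (seq nat)) :
  descent_set n R -> Rchain n R B -> chain_gap_free R B ->
  gapless_tuple n R (chain_tuple n R B).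
Proof.
move=> dR cB gB; have [[szB sB] _ _ _ sizes] := cB.
have tE i : 1 <= i <= n -> exists h, [/\ h <= size R, qq n R h < i <= qq n R h.+1 &
    ent (chain_tuple n R B) i = ent (nth [::] B h.+1) i].
  move=> i_in; have [c_in q_in] := carrel_bounds dR i_in.
  exists (carrel R i).-1; have c_eq : (carrel R i).-1.+1 = carrel R i by lia.
  split; [by lia | by rewrite c_eq | by rewrite c_eq ent_map_iota].
split.
- split; first by rewrite size_map size_iota.
  move=> i i_in; have [h [le_h q_in ->]] := tE i i_in.
  by apply: (Rchain_bounds cB (h := h.+1)) => //; rewrite mem_nth // sizes //; lia.
- move=> i i_in; have [h [le_h q_in ->]] := tE i i_in.
  case: i i_in q_in => // i _ q_in; rewrite /ent /=.
  apply: sorted_ltn_nth_ge; [exact: sB | | by rewrite sizes //; lia].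
  by move=> x /(Rchain_bounds cB (h := h.+1)) => /(_ le_h) /andP [].
- case=> // h /= le_h i i_in.
  rewrite !(chain_tupleE (h := h) _ dR le_h) //; try lia.
  by rewrite /ent; apply: (sorted_ltn_nth ltn_trans 0 (sB _ le_h)); rewrite ?inE ?sizes //=; lia.
case=> // h /= le_h.
have q1 := qq_ltn dR (ltnSn h) (leqW le_h).
have q2 := qq_ltn dR (ltnSn h.+1) le_h.
rewrite (chain_tupleE (h := h) (i := qq n R h.+1) _ dR (ltnW le_h)); last by lia.
rewrite (chain_tupleE (h := h.+1) _ dR le_h); last by lia.
set A := nth [::] B h.+1; set C := nth [::] B h.+2; move=> lt_xm.
have szA : size A = qq n R h.+1 by rewrite sizes //; lia.
have szC : size C = qq n R h.+2 by rewrite sizes.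
have sA : sorted ltn A by apply: sB; lia.
have sC : sorted ltn C by apply: sB.
have subAC : {subset A <= C} by apply: (Rchain_sub cB).
have mA : ent A (qq n R h.+1) \in A by rewrite /ent mem_nth // szA; lia.
have int x : nth 0 C (qq n R h.+1) <= x <= ent A (qq n R h.+1) -> x \in C.
  rewrite -{1}szA; apply: (gap_free_interval sA sC subAC (gB _ le_h)) => //.
  by rewrite szA szC.
have lt_C : qq n R h.+1 < size C by rewrite szC.
rewrite /pp /=; set m := ent A _ in lt_xm mA int *.
have xE : ent C (qq n R h.+1).+1 = nth 0 C (qq n R h.+1) by [].
have runs t : nth 0 C (qq n R h.+1) + t <= m -> qq n R h.+1 + t < size C /\
    nth 0 C (qq n R h.+1 + t) = nth 0 C (qq n R h.+1) + t.
  by move=> le_t; apply: (sorted_ltn_interval sC lt_C le_t int).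
have [|lt_s _] := runs (m - nth 0 C (qq n R h.+1)); first by lia.
rewrite szC in lt_s; split; first by lia.
move=> t t_in; rewrite (chain_tupleE (h := h.+1) _ dR le_h); last by lia.
(* The [t]-th entry of the carrel has offset [t.-1] from its start. *)
have [|_ tE'] := runs t.-1; first by lia.
have x_gt0 : 0 < nth 0 C (qq n R h.+1).
  by case/andP: (Rchain_bounds cB (h := h.+2) le_h (mem_nth 0 lt_C)).
rewrite -/C xE [LHS]/ent (_ : (qq n R h.+1 + t).-1 = qq n R h.+1 + t.-1) ?tE'; lia.
Qed.

(** * Row end max tableaux *)

Lemma tableau_row (n : nat) (lam : seq nat) (T : seq (seq nat)) (j k i : nat) :
  tableau n lam T -> 1 <= j <= k -> k <= ent lam 1 -> 1 <= i <= zeta lam k ->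
  Tent T j i <= Tent T k i.
Proof.
case=> _ _ rows; elim: k => [|k IH] le_jk le_k i_in; first by lia.
have [->//|neq] := eqVneq j k.+1.
apply: leq_trans (rows k i _ i_in); last by lia.
by apply: IH; [lia | lia | have := zeta_anti lam (leqnSn k); lia].
Qed.

(** A tableau [U] with the same row ends is bounded by induction on the level and, within a column,
    upwards from the bottom. Rows in the last carrel of the column are bounded by their row ends. In
    a row above, the key entry is either one less than the entry below it or equal to the entry of
    the previous level, so the bound comes from the cell below or from a column further right. *)
Lemma chain_key_is_M (n : nat) (lam : seq nat) (B : seq (seq nat)) :
  0 < n -> is_partition n lam -> Rchain n (R_of n lam) B -> chain_gap_free (R_of n lam) B ->
  is_M n lam (chain_tuple n (R_of n lam) B) (chain_to_key n lam B).
Proof.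
move=> n0 plam cB gB; have dR := R_of_descent_set lam n0.
have [[szB sB] _ _ _ sizes] := cB.
split; [by case: (Rchain_lam_key n0 plam cB) | exact: rowend_key | move=> U tU rU].
have [szU cols rows] := tU.
(* [d] counts the rows of the column below row [i]. *)
suff bound h : h <= (size (R_of n lam)).+1 -> forall j, 1 <= j <= ent lam 1 ->
    zeta lam j = qq n (R_of n lam) h -> forall d i, 1 <= i -> i + d = qq n (R_of n lam) h ->
    Tent U j i <= ent (nth [::] B h) i.
  move=> j i j_in i_in; rewrite /Tent (col_key _ _ j_in).
  have /andP [_ le_l] := col_level_bounds n0 plam j_in.
  have zE := qq_col_level n0 plam j_in.
  by apply: (bound _ le_l j j_in (esym zE) (zeta lam j - i)); lia.
elim: h => [|h IHh] le_h j j_in zE; first by move=> d i; rewrite /qq /=; lia.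
have q_lt := qq_ltn dR (ltnSn h) le_h.
have le_qn := zeta_le j plam.
(* These rows end in a column of the same length as column [j], where the entry of [U] is
   prescribed. *)
have carrel_le i : qq n (R_of n lam) h < i -> i <= qq n (R_of n lam) h.+1 ->
    Tent U j i <= ent (nth [::] B h.+1) i.
  move=> lt_qi le_iq; have i_in : 1 <= i <= n by lia.
  have le_jl : j <= ent lam i by rewrite -(zeta_ge _ plam) // zE.
  have [|le_1 zE'] := zeta_row_end n0 plam i_in; first by lia.
  have cE : carrel (R_of n lam) i = h.+1 by apply: (carrel_eq dR) => //; rewrite lt_qi.
  have := congr1 (ent^~ i) rU; rewrite /= !ent_map_iota // cE gtn_eqF; last by lia.
  move=> <-; apply: (tableau_row tU) => //; first by lia.
  by rewrite zE' cE; lia.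
elim=> [|d IHd] i i_gt0 i_eq; first by apply: carrel_le; lia.
have [lt_qi|le_iq] := ltnP (qq n (R_of n lam) h) i; first by apply: carrel_le; lia.
have [h0|h_gt0] := posnP h; first by move: le_iq; rewrite h0 /qq /=; lia.
have [|k k_in zk] := @col_of_level n lam h; first by lia.
(* Column [k] is shorter and so lies to the right; weak increase along the row carries its bound
   back to column [j]. *)
have lt_jk : j < k.
  by rewrite ltnNge; apply/negP => /(zeta_anti lam); lia.
have Uk : Tent U j i <= ent (nth [::] B h) i.
  apply: leq_trans (IHh (ltnW le_h) k k_in zk (qq n (R_of n lam) h - i) i i_gt0 _); last by lia.
  by apply: (tableau_row tU); lia.
have US : Tent U j i.+1 <= ent (nth [::] B h.+1) i.+1 by apply: IHd; lia.
have Ulast : Tent U j i < Tent U j i.+1.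
  have [sz sc _] := cols j j_in; rewrite /Tent /ent.
  by apply: (sorted_ltn_nth ltn_trans) => //; rewrite ?inE ?sz; lia.
have szh := sizes _ (ltnW le_h); have szh1 := sizes _ le_h.
case: i i_gt0 i_eq le_iq Uk US Ulast => // i _ i_eq le_iq Uk US Ulast.
have [||E|E] := @gap_free_nth _ _ i (sB _ (ltnW le_h)) (sB _ le_h)
  (Rchain_sub cB (leqnSn h) le_h) (gB _ le_h); rewrite ?szh ?szh1; try lia.
  have E' : ent (nth [::] B h.+1) i.+2 = (ent (nth [::] B h.+1) i.+1).+1 := E.
  by lia.
have E' : ent (nth [::] B h) i.+1 = ent (nth [::] B h.+1) i.+1 := E.
by lia.
Qed.

Lemma tableau_antisym (n : nat) (lam : seq nat) (T U : seq (seq nat)) :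
  tableau n lam T -> tableau n lam U -> tle lam T U -> tle lam U T -> T = U.
Proof.
move=> [szT colT _] [szU colU _] leTU leUT.
apply: (@eq_from_nth _ [::]); first by rewrite szT szU.
rewrite szT => k lt_k; have k_in : 1 <= k.+1 <= ent lam 1 by [].
rewrite -[LHS]/(col T k.+1) -[RHS]/(col U k.+1).
have [sT _ _] := colT _ k_in; have [sU _ _] := colU _ k_in.
apply: (@eq_from_nth _ 0); first by rewrite sT sU.
rewrite sT => i lt_i; apply/eqP; rewrite eqn_leq.
by rewrite (leTU k.+1 i.+1) ?(leUT k.+1 i.+1).
Qed.

Lemma is_M_uniq (n : nat) (lam : seq nat) (a : seq nat) (T U : seq (seq nat)) :
  is_M n lam a T -> is_M n lam a U -> T = U.
Proof.
move=> [tT rT maxT] [tU rU maxU]; apply: (tableau_antisym tT tU); [exact: maxU | exact: maxT].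
Qed.

(** * Chains from gapless tuples *)

(** [x :: C] is the next carrel, and [D] precedes it in the new level. The last hypothesis puts
    every element of [A] from [x] on into the carrel and excludes gaps there. Below [x] there are
    none because all values from some threshold up to [x] are taken. As [size A < x], there is room
    for [size A] values below [x]. *)
Lemma gap_free_extension (n : nat) (A C : seq nat) (x : nat) :
  sorted ltn A -> (forall y, y \in A -> 1 <= y <= n) ->
  sorted ltn (x :: C) -> (forall y, y \in x :: C -> 1 <= y <= n) -> size A < x ->
  (forall a y, a \in A -> x <= y <= a -> y \in x :: C) ->
  exists D, [/\ sorted ltn (D ++ x :: C), size D = size A,
    forall y, y \in D -> 1 <= y <= n, {subset A <= D ++ x :: C} & gap_free A (D ++ x :: C)].
Proof.
move=> sA bA sC bC lt_Ax AC.
have uA : uniq A := sorted_uniq ltn_trans ltnn sA.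
pose low t := [seq y <- iota 1 x.-1 | (y \in A) || (t <= y)].
(* [size (low t)] decreases from [x - 1 >= size A] to at most [size A] by steps
   of at most one, so it takes the value [size A]. *)
have low1 : size A <= size (low 0).
  by rewrite /low (eq_filter (a2 := predT)) ?filter_predT ?size_iota; [lia | move=> y; rewrite /= orbT].
have lowx : size (low x) <= size A.
  apply: uniq_leq_size; first exact/filter_uniq/iota_uniq.
  by move=> y; rewrite mem_filter mem_iota => /andP [/orP [//|le_xy] y_in]; lia.
have lowS t : size (low t) <= (size (low t.+1)).+1.
  rewrite -[X in _ <= X]/(size (t :: low t.+1)); apply: uniq_leq_size.
    exact/filter_uniq/iota_uniq.
  move=> y; rewrite inE !mem_filter => /andP [P ->]; rewrite andbT.
  by move: P; case: (y \in A); rewrite ?orbT //= leq_eqVlt eq_sym.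
have [t tE] : exists t, size (low t) = size A.
  have exP : exists t, size (low t) <= size A by exists x.
  case: (ex_minnP exP) => t le_t t_min; exists t; apply/eqP; rewrite eqn_leq le_t /=.
  case: t le_t t_min => // t le_t t_min.
  have lt_t : size A < size (low t).
    by rewrite ltnNge; apply/negP => /t_min; rewrite ltnn.
  exact: leq_trans lt_t (lowS t).
have minC y : y \in x :: C -> x <= y.
  rewrite inE => /orP [/eqP -> //|y_in].
  by move/(order_path_min ltn_trans)/allP: (sC) => /(_ y y_in) /ltnW.
have x_in := bC x (mem_head _ _).
have low_in y : y \in low t -> 1 <= y < x.
  by rewrite mem_filter mem_iota => /andP [_]; lia.
exists (low t); split=> //.
- have slow : sorted ltn (low t) by apply: sorted_filter (iota_ltn_sorted _ _); apply: ltn_trans.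
  move: slow sC; rewrite !(sorted_pairwise ltn_trans) pairwise_cat => -> ->.
  rewrite !andbT; apply/allrelP => u v /low_in lt_u /minC le_v /=; lia.
- by move=> y /low_in; lia.
- move=> a aA; rewrite mem_cat; have [lt_a|ge_a] := ltnP a x; last first.
    by rewrite (AC a) ?orbT // ge_a leqnn.
  by rewrite mem_filter aA mem_iota; have := bA a aA; lia.
move=> a b c aA; rewrite !mem_cat => b_in nbA lt_bca.
have [lt_c|ge_c] := ltnP c x; last by rewrite (AC a) ?orbT //; lia.
(* [b] is below [x] and outside [A], so it passed the threshold [t], and so does the larger [c]. *)
have : b \in low t by case/orP: b_in => // /minC; lia.
rewrite !mem_filter (negbTE nbA) /= !mem_iota => /andP [le_t b_bd].
by apply/orP; left; rewrite orbC; lia.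
Qed.

(** A partial chain is a function of the level, so that a level is added by redefining the values
    beyond [k]. The last condition makes its row ends agree with [g] so far. *)
Definition chain_upto (n : nat) (R g : seq nat) (k : nat) (f : nat -> seq nat) : Prop :=
  [/\ f 0 = [::],
      forall h, h <= k -> [/\ sorted ltn (f h), size (f h) = qq n R h &
        forall y, y \in f h -> 1 <= y <= n] &
      forall h, h < k -> [/\ {subset f h <= f h.+1}, gap_free (f h) (f h.+1) &
        forall i, qq n R h < i <= qq n R h.+1 -> ent (f h.+1) i = ent g i]].

Lemma chain_uptoS (n : nat) (R g : seq nat) (k : nat) (f : nat -> seq nat) :
  descent_set n R -> gapless_tuple n R g -> k <= size R ->
  chain_upto n R g k f -> exists f', chain_upto n R g k.+1 f'.
Proof.
move=> dR [[szg bg] upg incg gapg] le_k [f0 levels steps].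
have q_lt := qq_ltn dR (ltnSn k) le_k.
have le_n : qq n R k.+1 <= n by rewrite -{2}(qq_last n R) qq_leq.
have [sA szA bA] := levels k (leqnn k).
pose x := ent g (qq n R k).+1.
pose C := [seq ent g i | i <- iota (qq n R k).+2 (qq n R k.+1 - qq n R k).-1].
have CE : x :: C = [seq ent g i | i <- iota (qq n R k).+1 (qq n R k.+1 - qq n R k)].
  by rewrite -(prednK (n := qq n R k.+1 - qq n R k)) //; lia.
have szC : size (x :: C) = qq n R k.+1 - qq n R k by rewrite CE size_map size_iota.
have nthC i : i < qq n R k.+1 - qq n R k -> nth 0 (x :: C) i = ent g ((qq n R k).+1 + i).
  by move=> lt_i; rewrite CE (nth_map 0) ?size_iota // nth_iota.
have memC i : qq n R k < i <= qq n R k.+1 -> ent g i \in x :: C.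
  by move=> i_in; rewrite CE; apply: map_f; rewrite mem_iota; lia.
have sC : sorted ltn (x :: C).
  apply/(sortedP 0) => i; rewrite szC => lt_i; rewrite !nthC //; last by lia.
  by rewrite addnS; apply: (incg k.+1) => /=; lia.
have bC y : y \in x :: C -> 1 <= y <= n.
  by rewrite CE => /mapP [i]; rewrite mem_iota => i_in ->; apply: bg; lia.
have lt_x : size (f k) < x by rewrite szA; apply: upg; lia.
(* The greatest element of level [k] is entry [qq n R k] of [g]. If [x < y <= a], that entry exceeds
   [x], and the run imposed on [g] at this descent has [y] as its entry number [y - x + 1]. *)
have AC a y : a \in f k -> x <= y <= a -> y \in x :: C.
  move=> aA y_in; have [k0|k_gt0] := posnP k; first by move: aA; rewrite k0 f0.
  have le_am := sorted_ltn_le_last sA aA; rewrite szA in le_am.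
  have := steps k.-1; rewrite prednK // => /(_ (leqnn _)) [_ _ /(_ (qq n R k))].
  have qk := @qq_ltn n R k.-1 k dR ltac:(lia) ltac:(lia).
  rewrite qk leqnn => /(_ isT) mE; rewrite mE in le_am.
  have [->|nyx] := eqVneq y x; first exact: mem_head.
  have [||le_s runs] := gapg k; try by rewrite -/x; lia.
  rewrite /pp /= in le_s; have := runs (y - x).+1; rewrite -/x in le_s *.
  move=> /(_ ltac:(lia)) yE.
  have -> : y = ent g (qq n R k + (y - x).+1) by rewrite yE; lia.
  by apply: memC; lia.
have [D [sD szD bD subD gD]] := gap_free_extension sA bA sC bC lt_x AC.
exists (fun h => if h <= k then f h else D ++ x :: C); split.
- by rewrite f0.
- move=> h le_h; case: (leqP h k) => [/levels //|lt_kh].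
  have -> : h = k.+1 by lia.
  split=> //; first by rewrite size_cat szC szD szA; lia.
  by move=> y; rewrite mem_cat => /orP [/bD|/bC].
move=> h le_hk; have [->|neq] := eqVneq h k; last first.
  have lt_hk : h < k by lia.
  by rewrite (ltnW lt_hk) lt_hk; apply: steps.
rewrite leqnn ltnn; split=> // i i_in.
rewrite /ent nth_cat szD szA ltnNge (_ : qq n R k <= i.-1); last by lia.
rewrite /= -/(nth 0 (x :: C) _) nthC; last by lia.
by congr (ent g _); lia.
Qed.

Lemma gapless_tuple_chain (n : nat) (R g : seq nat) :
  descent_set n R -> gapless_tuple n R g ->
  exists B, [/\ Rchain n R B, chain_gap_free R B & chain_tuple n R B = g].
Proof.
move=> dR gg.
have [f [f0 levels steps]] : exists f, chain_upto n R g (size R).+1 f.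
  have : (size R).+1 <= (size R).+1 by [].
  elim: {1 3}(size R).+1 => [_|k IH lt_k].
    by exists (fun=> [::]); split=> // h; rewrite ?ltn0 // leqn0 => /eqP ->.
  by have [f] := IH (ltnW lt_k); apply: chain_uptoS.
have nthF h : h <= (size R).+1 -> nth [::] (mkseq f (size R).+2) h = f h.
  by move=> le_h; rewrite nth_mkseq.
exists (mkseq f (size R).+2); split.
- split; rewrite ?nthF //.
  + split; first by rewrite size_mkseq.
    by move=> h le_h; rewrite nthF //; case: (levels h le_h).
  + have [s sz b] := levels _ (leqnn _); apply: sorted_ltn_full => //.
    by rewrite sz qq_last.
  + move=> h le_h; rewrite !nthF //; last by lia.
    have [subf _ _] := steps h le_h; split=> //.
    have [_ sz1 _] := levels h (leqW le_h); have [_ sz2 _] := levels h.+1 le_h.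
    apply/eqP => /(congr1 size); rewrite sz1 sz2.
    by have := qq_ltn dR (ltnSn h) le_h; lia.
  + by move=> h le_h; rewrite nthF //; case: (levels h le_h).
- by move=> h le_h; rewrite !nthF //; [case: (steps h le_h) | lia].
case: gg => [[szg _] _ _ _].
apply: (@eq_from_nth _ 0); first by rewrite size_map size_iota szg.
move=> i; rewrite size_map size_iota => lt_i.
have i_in : 1 <= i.+1 <= n by [].
have [c_in q_in] := carrel_bounds dR i_in.
rewrite -[LHS]/(ent (chain_tuple n R _) i.+1) -[RHS]/(ent g i.+1) ent_map_iota //.
rewrite nthF; last by lia.
have [_ _] := steps (carrel R i.+1).-1 ltac:(lia).
by rewrite prednK; [apply | lia].
Qed.

(** * R-permutations and their chains *)

Lemma chain_ofE (n : nat) (R pi : seq nat) (h : nat) :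
  h <= (size R).+1 -> nth [::] (chain_of n R pi) h = sort leq (take (qq n R h) pi).
Proof. by move=> le_h; rewrite (nth_map 0) ?size_iota // nth_iota. Qed.

Lemma mem_chain_of (n : nat) (R pi : seq nat) (h : nat) :
  h <= (size R).+1 -> nth [::] (chain_of n R pi) h =i take (qq n R h) pi.
Proof. by move=> le_h x; rewrite chain_ofE // mem_sort. Qed.

Lemma sort_leq_sorted_ltn (s : seq nat) : uniq s -> sorted ltn (sort leq s).
Proof. by move=> us; rewrite ltn_sorted_uniq_leq sort_uniq us (sort_sorted leq_total). Qed.

Lemma Rchain_chain_of (n : nat) (R pi : seq nat) :
  descent_set n R -> Rperm n R pi -> Rchain n R (chain_of n R pi).
Proof.
move=> dR [pi_perm _].
have upi : uniq pi by rewrite (perm_uniq pi_perm) iota_uniq.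
have szpi : size pi = n by rewrite (perm_size pi_perm) size_iota.
have sizes h : h <= (size R).+1 -> size (nth [::] (chain_of n R pi) h) = qq n R h.
  move=> le_h; rewrite chain_ofE // size_sort size_takel // szpi.
  by rewrite -{2}(qq_last n R) qq_leq.
have srt h : h <= (size R).+1 -> sorted ltn (nth [::] (chain_of n R pi) h).
  by move=> le_h; rewrite chain_ofE //; apply/sort_leq_sorted_ltn/take_uniq.
split=> //.
- by rewrite size_map size_iota.
- by apply/eqP; rewrite -size_eq0 sizes.
- apply: sorted_ltn_full; [exact: srt | by rewrite sizes // qq_last |].
  move=> x; rewrite mem_chain_of // => /mem_take; rewrite (perm_mem pi_perm) mem_iota; lia.
- move=> h le_h; have q_lt := qq_ltn dR (ltnSn h) le_h; split.
    move=> x; rewrite !mem_chain_of //; last by lia.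
    by rewrite -(subnKC (ltnW q_lt)) takeD mem_cat => ->.
  by apply/eqP => /(congr1 size); rewrite !sizes //; lia.
Qed.

(** A value lies in level [h] exactly when its position is at most [qq n R h]. Hence in a 312
    pattern the value at [a] belongs to level [h], the one at [b] is new in level [h.+1], and the
    one at [c] lies outside level [h.+1]: a violation of gap-freeness. *)
Lemma R312_avoiding_gap_free (n : nat) (R pi : seq nat) :
  descent_set n R -> Rperm n R pi ->
  (R312_avoiding n R pi <-> chain_gap_free R (chain_of n R pi)).
Proof.
move=> dR Ppi; have cB := Rchain_chain_of dR Ppi; case: Ppi => pi_perm _.
have upi : uniq pi by rewrite (perm_uniq pi_perm) iota_uniq.
have szpi : size pi = n by rewrite (perm_size pi_perm) size_iota.
have memB h x : h <= (size R).+1 -> x \in pi ->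
    (x \in nth [::] (chain_of n R pi) h) = (index x pi < qq n R h).
  by move=> le_h x_in; rewrite mem_chain_of // in_take.
have in_pi h x : h <= (size R).+1 -> x \in nth [::] (chain_of n R pi) h -> x \in pi.
  by move=> le_h; rewrite mem_chain_of // => /mem_take.
split=> [avoid|gB [h [a [b [c [h_in a_in b_in c_in lt_bca]]]]]].
  apply: (chain_gap_free_inner cB) => h h_in a b c aA bB nbA lt_bca.
  apply/negPn/negP => ncB; apply: avoid.
  have api : a \in pi by apply: (in_pi h) => //; lia.
  have bpi : b \in pi by apply: (in_pi h.+1) => //; lia.
  (* [c] occurs in [pi] because it lies between two values in [[n]]. *)
  have cpi : c \in pi.
    move: api bpi; rewrite !(perm_mem pi_perm) !mem_iota; lia.
  rewrite !memB // in aA bB nbA ncB; try lia.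
  exists h, (index a pi).+1, (index b pi).+1, (index c pi).+1.
  rewrite /ent /= !nth_index //.
  have : index c pi < n by rewrite -szpi index_mem.
  by split=> //; lia.
have q1 := @qq_ltn n R h h.+1 dR (ltnSn h) ltac:(lia).
have le_n : qq n R h.+1 <= n by rewrite -{2}(qq_last n R) qq_leq //; lia.
have entP i : 1 <= i <= n -> ent pi i \in pi /\ index (ent pi i) pi = i.-1.
  by move=> i_in; rewrite /ent mem_nth ?index_uniq // szpi; lia.
have [|api ai] := entP a; first by lia.
have [|bpi bi] := entP b; first by lia.
have [|cpi ci] := entP c; first by lia.
have := gB h _ (ent pi a) (ent pi b) (ent pi c); rewrite !memB //; lia.
Qed.

Lemma Ylam_chain_of (n : nat) (lam pi : seq nat) :
  0 < n -> is_partition n lam ->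
  Ylam lam pi = chain_to_key n lam (chain_of n (R_of n lam) pi).
Proof.
move=> n0 plam; apply/eq_in_map => j; rewrite mem_iota => j_in.
have {}j_in : 1 <= j <= ent lam 1 by lia.
rewrite -/(col_level n lam j) chain_ofE ?qq_col_level //.
by case/andP: (col_level_bounds n0 plam j_in).
Qed.

(** Among [q] values, the one of rank [q - i + 1] from the top is the [i]-th from the bottom. *)
Lemma Psi_chain_of (n : nat) (R pi : seq nat) :
  descent_set n R -> Rperm n R pi -> Psi n R pi = chain_tuple n R (chain_of n R pi).
Proof.
move=> dR Ppi; have [[_ srt] _ _ _ sizes] := Rchain_chain_of dR Ppi.
apply/eq_in_map => i; rewrite mem_iota => i_in.
have {}i_in : 1 <= i <= n by lia.
have [c_in q_in] := carrel_bounds dR i_in.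
have /srt sB : carrel R i <= (size R).+1 by lia.
have /sizes szB : carrel R i <= (size R).+1 by lia.
set B := nth _ _ _ in sB szB *; rewrite /rank undup_id; last first.
  exact: sorted_uniq ltn_trans ltnn _ sB.
have -> : sort geq B = rev B.
  apply: (sorted_eq (leT := geq)); last by rewrite perm_sym perm_rev perm_sym perm_sort.
  - by move=> x y z /= le_xy le_zx; apply: leq_trans le_zx le_xy.
  - by move=> x y /= /anti_leq.
  - by apply: sort_sorted => x y; apply: leq_total.
  - by rewrite rev_sorted; move: sB; rewrite ltn_sorted_uniq_leq => /andP [].
by rewrite /ent nth_rev szB; [congr (nth 0 B); lia | lia].
Qed.

(** Each level contributes its new elements in increasing order, so that prefixes of the word list
    the levels and the word increases on every carrel. *)
Fixpoint chain_word (B : seq (seq nat)) (h : nat) : seq nat :=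
  if h is k.+1
  then chain_word B k ++ [seq x <- nth [::] B h | x \notin nth [::] B k] else [::].

Lemma chain_Rperm (n : nat) (R : seq nat) (B : seq (seq nat)) :
  descent_set n R -> Rchain n R B -> exists2 pi, Rperm n R pi & chain_of n R pi = B.
Proof.
move=> dR cB; have [[szB srt] B0 Bn subB sizes] := cB.
have words h : h <= (size R).+1 -> perm_eq (chain_word B h) (nth [::] B h).
  elim: h => [|h IH] le_h /=; first by rewrite B0.
  have [sub_h _] := subB h le_h.
  have uh : uniq (nth [::] B h) := sorted_uniq ltn_trans ltnn (srt h (ltnW le_h)).
  have uh1 : uniq (nth [::] B h.+1) := sorted_uniq ltn_trans ltnn (srt h.+1 le_h).
  have -> : perm_eq (chain_word B h ++ [seq x <- nth [::] B h.+1 | x \notin nth [::] B h])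
      (nth [::] B h.+1) = perm_eq (nth [::] B h ++ [seq x <- nth [::] B h.+1 | x \notin nth [::] B h])
      (nth [::] B h.+1).
    by apply: permPl; rewrite perm_cat2r; apply: IH; apply: ltnW.
  rewrite perm_sym -(perm_filterC (mem (nth [::] B h))) perm_cat2r.
  rewrite uniq_perm ?filter_uniq // => x; rewrite mem_filter /=.
  by apply/andP/idP => [[]//|x_in]; split=> //; apply: sub_h.
have szw h : h <= (size R).+1 -> size (chain_word B h) = qq n R h.
  by move=> le_h; rewrite (perm_size (words h le_h)) sizes.
have takew h k : h <= k -> k <= (size R).+1 -> take (qq n R h) (chain_word B k) = chain_word B h.
  elim: k => [|k IH]; first by rewrite leqn0 => /eqP ->.
  rewrite leq_eqVlt => /orP [/eqP -> le_k|lt_hk le_k]; first by rewrite -szw // take_size.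
  rewrite /= takel_cat ?szw; first exact: IH (ltnW le_k).
  - by apply: qq_leq => //; apply: ltnW.
  - exact: ltnW.
pose pi := chain_word B (size R).+1.
have take_pi h : h <= (size R).+1 -> take (qq n R h) pi = chain_word B h.
  by move=> le_h; apply: takew.
have Ppi : Rperm n R pi.
  split; first by rewrite -Bn words.
  case=> // h /= le_h i i_in.
  have ent_pi k : k <= qq n R h.+1 -> qq n R h < k -> ent pi k =
      nth 0 [seq x <- nth [::] B h.+1 | x \notin nth [::] B h] (k.-1 - qq n R h).
    move=> le_k lt_k; rewrite /ent -(nth_take (n0 := qq n R h.+1)); last by lia.
    rewrite take_pi //= nth_cat szw; last exact: ltnW.
    by rewrite ltnNge (_ : qq n R h <= k.-1) //; lia.
  rewrite !ent_pi; try lia.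
  have szblock : size [seq x <- nth [::] B h.+1 | x \notin nth [::] B h] = qq n R h.+1 - qq n R h.
    by have := szw h.+1 le_h; rewrite /= size_cat szw; [lia | exact: ltnW].
  have sblock : sorted ltn [seq x <- nth [::] B h.+1 | x \notin nth [::] B h].
    by apply: sorted_filter (srt _ le_h); apply: ltn_trans.
  by apply: (sorted_ltn_nth ltn_trans 0 sblock); rewrite ?inE ?szblock; lia.
exists pi => //.
apply: (Rchain_eq (Rchain_chain_of dR Ppi) cB) => h h_in.
have le_h : h <= (size R).+1 by lia.
rewrite chain_ofE // take_pi //.
apply: (sorted_eq leq_trans anti_leq); first exact: (sort_sorted leq_total).
  by have := srt h le_h; rewrite ltn_sorted_uniq_leq => /andP [].
by rewrite perm_sort words.
Qed.

Theorem theorem5p2 (n : nat) (lam : seq nat) :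
  1 <= n -> is_partition n lam ->
  let R := R_of n lam in
  (* (i) *)
  (forall T : seq (seq nat),
     ((exists pi, [/\ Rperm n R pi, R312_avoiding n R pi & T = Ylam lam pi])
        <-> gapless_key n lam T) /\
     (gapless_key n lam T <-> exists g, gapless_tuple n R g /\ is_M n lam g T)) /\
  (* (ii) *)
  (forall pi, Rperm n R pi ->
     (R312_avoiding n R pi <-> gapless_key n lam (Ylam lam pi))) /\
  (* (iii) *)
  (forall pi, Rperm n R pi -> R312_avoiding n R pi ->
     is_M n lam (Psi n R pi) (Ylam lam pi)) /\
  (* chains: bijection from RCD R-chains onto gapless lam-keys *)
  [/\ forall B, Rchain n R B -> RCD n R B -> gapless_key n lam (chain_to_key n lam B),
      forall B B', Rchain n R B -> RCD n R B -> Rchain n R B' -> RCD n R B' ->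
        chain_to_key n lam B = chain_to_key n lam B' -> B = B' &
      forall Y, gapless_key n lam Y ->
        exists B, [/\ Rchain n R B, RCD n R B & chain_to_key n lam B = Y]] /\
  (* gamma |-> M_lam(gamma): bijection from gapless R-tuples onto their images *)
  ((forall g, gapless_tuple n R g -> exists T, is_M n lam g T) /\
   (forall g g' T, gapless_tuple n R g -> gapless_tuple n R g' ->
      is_M n lam g T -> is_M n lam g' T -> g = g')).
Proof.
move=> n0 plam R; have dR : descent_set n R := R_of_descent_set lam n0.
have avoidP pi : Rperm n R pi ->
    (R312_avoiding n R pi <-> gapless_key n lam (Ylam lam pi)).
  move=> Ppi; rewrite (Ylam_chain_of pi n0 plam) (R312_avoiding_gap_free dR Ppi).
  exact: iff_sym (gapless_key_gap_free n0 plam (Rchain_chain_of dR Ppi)).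
have key_chain Y : gapless_key n lam Y ->
    exists B, [/\ Rchain n R B, chain_gap_free R B & chain_to_key n lam B = Y].
  move=> gY; have [B cB BE] := lam_key_chain n0 plam (proj1 gY).
  by exists B; split=> //; apply/(gapless_key_gap_free n0 plam cB); rewrite BE.
split; [|split; [exact: avoidP | split; [|split; [split|split]]]].
- move=> T; split; split.
  + by case=> pi [Ppi avoid ->]; apply/avoidP.
  + move=> gT; have [B [cB _ BE]] := key_chain T gT.
    have [pi Ppi piE] := chain_Rperm dR cB.
    have TE : T = Ylam lam pi by rewrite (Ylam_chain_of pi n0 plam) -/R piE.
    by exists pi; split=> //; apply/avoidP; rewrite -?TE.
  + move=> gT; have [B [cB gB <-]] := key_chain T gT.
    exists (chain_tuple n R B); split; first exact: chain_tuple_gapless.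
    exact: chain_key_is_M.
  + case=> g [gg MT]; have [B [cB gB BE]] := gapless_tuple_chain dR gg.
    (* [g] is the tuple of the chain [B], so [T] and the key of [B] are maximal for the same row end
       list and agree. *)
    have MB := chain_key_is_M n0 plam cB gB; rewrite -/R BE in MB.
    by rewrite (is_M_uniq MT MB); apply/gapless_key_gap_free.
- move=> pi Ppi /(R312_avoiding_gap_free dR Ppi) gB.
  rewrite (Ylam_chain_of pi n0 plam) (Psi_chain_of dR Ppi).
  exact: chain_key_is_M (Rchain_chain_of dR Ppi) gB.
- by move=> B cB /(RCD_gap_free dR cB) gB; apply/gapless_key_gap_free.
- by move=> B B' cB _ cB' _; apply: chain_to_key_inj.
- move=> Y gY; have [B [cB gB BE]] := key_chain Y gY.
  by exists B; split=> //; apply/(RCD_gap_free dR cB).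
- move=> g gg; have [B [cB gB BE]] := gapless_tuple_chain dR gg.
  by exists (chain_to_key n lam B); rewrite -BE; apply: chain_key_is_M.
(* The row end list of [T] recovers the tuple. *)
- by move=> g g' T _ _ [_ <- _] [_ <- _].
Qed.
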